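(* There is a stopping rule $T$ for testing $\mathcal{D}_1=\mathcal{D}_2$ versus $\mathcal{D}_1\neq\mathcal{D}_2$ which decides $\mathcal{D}_1\neq\mathcal{D}_2$ with probability at least $9/10$ (i.e. when $\mathcal{D}_1=\mathcal{D}_2$ it ever outputs $2$ with probability at most $1/10$, and when $\mathcal{D}_1\ne\mathcal{D}_2$ it outputs $2$ with probability at least $9/10$) using at most $$\mathcal{O}\left(\frac{\log\log(1/d)}{d^2}\vee\frac{n^{2/3}\log\log(1/d)^{1/3}}{d^{4/3}}\vee\frac{n^{1/2}\log\log(1/d)^{1/2}}{d^2}\right)$$ samples, where $d=\mathrm{TV}(\mathcal{D}_1,\mathcal{D}_2)$ and $\mathcal{O}$ hides a universal constant.
   Context: Distributions $\mathcal{D}_1,\mathcal{D}_2$ on $[n]=\{1,\dots,n\}$ are unknown and observed through i.i.d. samples, one from each at every time step; $\mathrm{TV}(\mathcal{D},\mathcal{D}')=\frac12\sum_i|\mathcal{D}_i-\mathcal{D}'_i|$, $a\vee b=\max(a,b)$. A stopping rule for closeness is $T:\bigcup_k[n]^k\times[n]^k\to\{0,1,2\}$ with $T(x,y)\ne0\Rightarrow T(xz,yw)=T(x,y)$ whenever $|x|=|y|$, $|z|=|w|$; outputting $2$ means declaring $\mathcal{D}_1\ne\mathcal{D}_2$. In this problem there is no slack parameter: the rule should not stop when $\mathcal{D}_1=\mathcal{D}_2$, and should declare $\mathcal{D}_1\ne\mathcal{D}_2$ when the distributions differ.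
   Formalization: In the sample bound, log log(1/d) is read as max(1, log log(1/d)), because it is undefined at d = 1, negative for 1/e < d < 1, and zero at d = 1/e, where the bound would allow no samples; nothing changes for d ≤ e^{-e}. *)

(* Defs.v *)
From HB Require Import structures.
From mathcomp Require Export all_boot all_order all_algebra.
From mathcomp Require Export all_classical all_reals all_analysis.
Set Implicit Arguments.
Unset Strict Implicit.
Unset Printing Implicit Defensive.
Import Order.TTheory GRing.Theory Num.Theory.

Local Open Scope classical_set_scope.
Local Open Scope ring_scope.

(* The set [n] = {1, ..., n} is represented by 'I_n. *)
Definition is_distribution (R : realType) (n : nat) (D : {ffun 'I_n -> R}) :
    Prop :=
  (forall i, 0 <= D i) /\ \sum_(i < n) D i = 1.

Definition TV (R : realType) (n : nat) (D D' : {ffun 'I_n -> R}) : R :=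
  2^-1 * \sum_(i < n) `|D i - D' i|.

Definition test_rule (n : nat) : Type :=
  forall k : nat, k.-tuple 'I_n -> k.-tuple 'I_n -> 'I_3.

Definition stopping_rule (n : nat) (T : test_rule n) : Prop :=
  forall (k l : nat) (x y : k.-tuple 'I_n) (z w : l.-tuple 'I_n),
    T k x y <> 0%N :> nat ->
    T (k + l)%N [tuple of x ++ z] [tuple of y ++ w] = T k x y.

(* Mutual independence of a family of variables with values in a finite type
   (with all its subsets measurable): the product rule over every finite
   subfamily. *)
Definition mutually_independent (R : realType) (d : measure_display)
    (Omega : measurableType d) (P : probability Omega R)
    (I : eqType) (A : finType) (Z : I -> Omega -> A) : Prop :=
  forall (J : seq I) (B : I -> set A), uniq J ->
    P [set w | forall j, j \in J -> B j (Z j w)] =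
    (\prod_(j <- J) P (Z j @^-1` B j))%E.

(* Two i.i.d. streams X_1, X_2, ... ~ D1 and Y_1, Y_2, ... ~ D2, independent of
   each other (the time index is shifted to start at 0). *)
Definition iid_samples (R : realType) (n : nat) (D1 D2 : {ffun 'I_n -> R})
    (d : measure_display) (Omega : measurableType d) (P : probability Omega R)
    (X Y : nat -> Omega -> 'I_n) : Prop :=
  [/\ forall t (B : set 'I_n),
        measurable (X t @^-1` B) /\ measurable (Y t @^-1` B),
      forall t i, P (X t @^-1` [set i]) = (D1 i)%:E,
      forall t i, P (Y t @^-1` [set i]) = (D2 i)%:E &
      mutually_independent P
        (fun s : nat + nat =>
           match s with inl t => X t | inr t => Y t end)].

(* The output of the rule after t time steps. *)
Definition output (n : nat) (T : test_rule n) (Omega : Type)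
    (X Y : nat -> Omega -> 'I_n) (t : nat) (w : Omega) : nat :=
  T t [tuple X i w | i < t] [tuple Y i w | i < t].

(* loglog(1/d) is undefined at d = 1, and nonpositive for d in [1/e, 1), so the
   rate is read, as usual, with loglog(1/d) replaced by max(1, loglog(1/d));
   this changes nothing when d <= exp(-e). *)
Definition loglog_inv (R : realType) (d : R) : R :=
  Num.max 1 (ln (ln d^-1)).

Definition sample_rate (R : realType) (n : nat) (d : R) : R :=
  Num.max (loglog_inv d / d ^+ 2)
    (Num.max
       (n%:R `^ (2 / 3) * loglog_inv d `^ (1 / 3) / d `^ (4 / 3))
       (n%:R `^ (1 / 2) * loglog_inv d `^ (1 / 2) / d ^+ 2)).

(* Main.v *)
(* Split the first 2m samples of each distribution into two halves and let
   X_i, Y_i (first half) and X'_i, Y'_i (second half) count the symbol i. The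
   statistic
     Z = sum_i sum_k (1[X_i <= k] - 1[Y_i <= k]) (1[X'_i <= k] - 1[Y'_i <= k])
   has mean sum_i sum_k (F_i k - G_i k)^2, where F_i and G_i are the cumulative
   distribution functions of Bin(m, D1 i) and Bin(m, D2 i), and moves by at most
   2 when one sample changes. It therefore deviates from its mean by
   sqrt(128 m L) with probability at most exp(-L) on either side.

   Exchanging the Bernoulli parameters p := D1 i and q := D2 i one at a time
   shows F_i k - G_i k = (q - p) S_k, where S is a sum of m probability mass
   functions, which is concentrated in a window of width of the order of
   w := 1 + sqrt(m (p + q)) + m |p - q|; by Cauchy-Schwarz the i-th term of the
   mean is at least m^2 (p - q)^2 / (12 w). A second Cauchy-Schwarz, over i,
   bounds the mean below by m^2 d^2 / (3 (n + sqrt(2nm) + 2md)).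

   Stage j of the rule tests at distance 2^-j with error probability
   1 / (10 (j+1)(j+2)), so L is of the order of log j, which is
   loglog(1/d) for the stage with 2^-j <= d <= 2 * 2^-j; the three terms of the
   rate make the mean exceed twice the threshold against the three terms of the
   denominator. *)
Require Import Defs.
From mathcomp Require Import ring lra.
Import Order.TTheory GRing.Theory Num.Theory.
Set Implicit Arguments.
Unset Strict Implicit.
Unset Printing Implicit Defensive.
Local Open Scope classical_set_scope.
Local Open Scope ring_scope.

(** * Expectation over independent samples *)

(** Independent draws, one from each law in [ds]. The first draw is averaged outermost, so an
    induction on [ds] conditions on it. *)
Fixpoint expect {R : realType} {n : nat} (ds : seq {ffun 'I_n -> R})
    (F : seq 'I_n -> R) : R :=
  if ds is d :: ds' then \sum_(a < n) d a * expect ds' (fun s => F (a :: s))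
  else F [::].

Definition distributions (R : realType) (n : nat) (ds : seq {ffun 'I_n -> R}) :=
  forall d, d \in ds -> is_distribution d.

Lemma distributions_cons (R : realType) (n : nat) (d : {ffun 'I_n -> R}) ds :
  distributions (d :: ds) -> is_distribution d /\ distributions ds.
Proof.
move=> h; split=> [|e he]; first by apply: h; rewrite mem_head.
by apply: h; rewrite in_cons he orbT.
Qed.

Lemma distributions_cat (R : realType) (n : nat) (ds es : seq {ffun 'I_n -> R}) :
  distributions ds -> distributions es -> distributions (ds ++ es).
Proof. by move=> h1 h2 d; rewrite mem_cat => /orP[/h1|/h2]. Qed.

Lemma distributions_nseq (R : realType) (n m : nat) (d : {ffun 'I_n -> R}) :
  is_distribution d -> distributions (nseq m d).
Proof. by move=> h e; rewrite mem_nseq => /andP[_ /eqP->]. Qed.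

Lemma eq_expect (R : realType) (n : nat) (ds : seq {ffun 'I_n -> R}) F G :
  (forall s, size s = size ds -> F s = G s) -> expect ds F = expect ds G.
Proof.
elim: ds F G => [|d ds IH] F G h /=; first exact: h.
by apply: eq_bigr => a _; congr (_ * _); apply: IH => s hs; apply: h; rewrite /= hs.
Qed.

Lemma le_expect (R : realType) (n : nat) (ds : seq {ffun 'I_n -> R}) F G :
  distributions ds -> (forall s, F s <= G s) -> expect ds F <= expect ds G.
Proof.
elim: ds F G => [|d ds IH] F G hd h /=; first exact: h.
have [[d0 _] hds] := distributions_cons hd.
by apply: ler_sum => a _; apply: ler_wpM2l => //; apply: IH.
Qed.

Lemma expectD (R : realType) (n : nat) (ds : seq {ffun 'I_n -> R}) F G :
  expect ds (fun s => F s + G s) = expect ds F + expect ds G.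
Proof.
elim: ds F G => [//|d ds IH] F G /=; rewrite -big_split /=.
by apply: eq_bigr => a _; rewrite IH mulrDr.
Qed.

Lemma expectZ (R : realType) (n : nat) (ds : seq {ffun 'I_n -> R}) c F :
  expect ds (fun s => c * F s) = c * expect ds F.
Proof.
elim: ds F => [//|d ds IH] F /=; rewrite big_distrr /=.
by apply: eq_bigr => a _; rewrite IH mulrCA.
Qed.

Lemma expectB (R : realType) (n : nat) (ds : seq {ffun 'I_n -> R}) F G :
  expect ds (fun s => F s - G s) = expect ds F - expect ds G.
Proof.
rewrite -[- expect ds G]mulN1r -expectZ -expectD.
by apply: eq_expect => s _; rewrite mulN1r.
Qed.

Lemma expect_cst (R : realType) (n : nat) (ds : seq {ffun 'I_n -> R}) c :
  distributions ds -> expect ds (fun=> c) = c.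
Proof.
elim: ds => [//|d ds IH] /distributions_cons[[_ d1] hds] /=.
by rewrite IH // -big_distrl /= d1 mul1r.
Qed.

Lemma expect_sum (R : realType) (n : nat) (ds : seq {ffun 'I_n -> R})
    (I : Type) (r : seq I) (F : I -> seq 'I_n -> R) :
  distributions ds ->
  expect ds (fun s => \sum_(i <- r) F i s) = \sum_(i <- r) expect ds (F i).
Proof.
move=> hd; elim: r => [|i r IH].
  by rewrite big_nil -[RHS](expect_cst 0 hd); apply: eq_expect => s _; rewrite big_nil.
rewrite big_cons -IH -expectD; apply: eq_expect => s _; by rewrite big_cons.
Qed.

Lemma expect_cat (R : realType) (n : nat) (ds es : seq {ffun 'I_n -> R}) F :
  expect (ds ++ es) F = expect ds (fun s => expect es (fun t => F (s ++ t))).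
Proof. by elim: ds F => [//|d ds IH] F /=; apply: eq_bigr => a _; rewrite IH. Qed.

(** * Concentration of functions with bounded differences *)

Definition neighbours (n : nat) (s t : seq 'I_n) : Prop :=
  exists s1 a b s2, s = s1 ++ a :: s2 /\ t = s1 ++ b :: s2.

Definition bounded_differences (R : realType) (n : nat) (c : R)
    (F : seq 'I_n -> R) : Prop :=
  forall s t, neighbours s t -> `|F s - F t| <= c.

(** [1 - x <= expR (- x)] gives [expR x * (1 - x) <= 1], while the right-hand side times [1 - x] is
    [1 + x ^+ 2 * (1 - 2 * x)], at least 1. *)
Lemma expR_quadratic (R : realType) (x : R) :
  x <= 2^-1 -> expR x <= 1 + x + 2 * x ^+ 2.
Proof.
move=> hx.
have h1 : 0 < 1 - x by lra.
have h2 : expR x * (1 - x) <= 1.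
  rewrite -[leRHS](expRxMexpNx_1 x) ler_wpM2l ?expR_ge0 //.
  exact: expR_ge1Dx.
rewrite -(ler_pM2r h1); apply: le_trans h2 _.
rewrite (_ : _ * (1 - x) = 1 + x ^+ 2 * (1 - 2 * x)); last by ring.
by rewrite lerDl mulr_ge0 ?sqr_ge0 //; lra.
Qed.

Lemma average_diff (R : realType) (n : nat) (d : {ffun 'I_n -> R}) (f : 'I_n -> R)
    (c : R) (a : 'I_n) :
  is_distribution d -> (forall b, `|f a - f b| <= c) ->
  `|f a - \sum_(b < n) d b * f b| <= c.
Proof.
move=> [d0 d1] h.
rewrite -[f a]mul1r -d1 mulr_suml -sumrB.
apply: le_trans (ler_norm_sum _ _ _) _.
rewrite -[c]mul1r -d1 mulr_suml; apply: ler_sum => b _.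
by rewrite -mulrBr normrM ger0_norm // ler_wpM2l.
Qed.

(** McDiarmid's martingale argument as an induction on the samples. Given the first draw [a], the
    induction hypothesis controls the fluctuation about the conditional mean [f a]; the centred
    variable [f a - mu] is bounded by [c] and costs one factor [expR (2 * (l * c) ^+ 2)]. *)
Lemma mgf_bounded_differences (R : realType) (n : nat)
    (ds : seq {ffun 'I_n -> R}) (F : seq 'I_n -> R) (c l : R) :
  distributions ds -> bounded_differences c F -> 0 <= l -> l * c <= 2^-1 ->
  expect ds (fun s => expR (l * (F s - expect ds F)))
    <= expR (2 * (l * c) ^+ 2 * (size ds)%:R).
Proof.
move=> + + l0 lc; elim: ds F => [|d ds IH] F /=.
  by rewrite subrr !mulr0.
move=> /distributions_cons[dd hds] hF.
pose f a := expect ds (fun s => F (a :: s)).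
pose mu := \sum_(a < n) d a * f a.
rewrite (_ : \sum_(a < n) d a * expect ds (fun s => F (a :: s)) = mu) //.
have hf a b : `|f a - f b| <= c.
  rewrite /f -expectB ler_norml; apply/andP; split.
    rewrite -[leLHS](expect_cst _ hds); apply: le_expect => // s.
    have /hF : neighbours (a :: s) (b :: s) by exists [::], a, b, s.
    by rewrite ler_norml => /andP[].
  rewrite -[leRHS](expect_cst _ hds); apply: le_expect => // s.
  have /hF : neighbours (a :: s) (b :: s) by exists [::], a, b, s.
  by rewrite ler_norml => /andP[].
have hfm a : `|f a - mu| <= c by exact: average_diff.
have [d0 d1] := dd.
set M := expR (2 * (l * c) ^+ 2 * (size ds)%:R).
apply: (@le_trans _ _ (\sum_(a < n) d a * (expR (l * (f a - mu)) * M))).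
  apply: ler_sum => a _; apply: ler_wpM2l => //.
  rewrite (_ : expect _ _ = expR (l * (f a - mu)) *
     expect ds (fun s => expR (l * (F (a :: s) - f a)))).
    rewrite ler_wpM2l ?expR_ge0 //; apply: IH => // s t [s1 [x [y [s2 [-> ->]]]]].
    by apply: hF; exists (a :: s1), x, y, s2.
  rewrite -expectZ; apply: eq_expect => s _; rewrite -expRD -/(f a); congr expR; ring.
rewrite (_ : _ * _.+1%:R = 2 * (l * c) ^+ 2 + 2 * (l * c) ^+ 2 * (size ds)%:R).
  rewrite expRD -/M; under eq_bigr do rewrite mulrA.
  rewrite -mulr_suml ler_wpM2r ?expR_ge0 //.
  apply: le_trans (expR_ge1Dx _).
  (* The linear term is kept apart because it sums to zero: [mu] is the mean of [f] under [d]. *)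
  apply: (@le_trans _ _ (\sum_(a < n) (d a * (1 + 2 * (l * c) ^+ 2)
     + l * (d a * f a - d a * mu)))).
    apply: ler_sum => a _.
    rewrite (_ : _ + _ = d a * (1 + l * (f a - mu) + 2 * (l * c) ^+ 2)); last by ring.
    apply: ler_wpM2l => //.
    have h : `|l * (f a - mu)| <= l * c by rewrite normrM ger0_norm // ler_wpM2l.
    apply: le_trans (expR_quadratic _) _.
      exact: le_trans (le_trans (ler_norm _) h) lc.
    by rewrite lerD2l ler_wpM2l // -(real_normK (num_real (l * (f a - mu)))) lerXn2r ?nnegrE // (le_trans _ h).
  rewrite big_split /= -mulr_suml d1 mul1r -mulr_sumr sumrB -mulr_suml d1 mul1r.
  by rewrite subrr mulr0 addr0.
rewrite -natr1; ring.
Qed.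

Lemma bounded_differences_tail (R : realType) (n : nat)
    (ds : seq {ffun 'I_n -> R}) (F : seq 'I_n -> R) (c t : R) :
  distributions ds -> bounded_differences c F -> 0 < c -> (0 < size ds)%N ->
  0 <= t -> t <= 2 * c * (size ds)%:R ->
  expect ds (fun s => (t <= F s - expect ds F)%R%:R)
    <= expR (- (t ^+ 2 / (8 * c ^+ 2 * (size ds)%:R))).
Proof.
move=> hds hF c0 s0 t0 ht.
set N : R := (size ds)%:R; have N0 : 0 < N by rewrite ltr0n.
(* Chernoff's bound: this [l] minimises [2 * (l * c) ^+ 2 * N - l * t], and [t <= 2 * c * N] says
   exactly that [l * c <= 2^-1]. *)
pose l := t / (4 * c ^+ 2 * N).
have l0 : 0 <= l by rewrite divr_ge0 // !mulr_ge0 // ?sqr_ge0 ?ltW.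
have lc : l * c <= 2^-1.
  rewrite (_ : l * c = t / (4 * c * N)); last by rewrite /l; field; rewrite !lt0r_neq0.
  by rewrite ler_pdivrMr ?mulr_gt0 // (le_trans ht) // le_eqVlt; apply/orP; left; apply/eqP; rewrite -/N; field.
apply: (@le_trans _ _ (expect ds (fun s => expR (- (l * t)) * expR (l * (F s - expect ds F))))).
  apply: le_expect => // s; rewrite -expRD; case: (leP t) => h; last by rewrite mulr0n expR_ge0.
  rewrite mulr1n.
  apply: le_trans (expR_ge1Dx _).
  by rewrite lerDl addrC -mulrBr mulr_ge0 // subr_ge0.
rewrite expectZ.
apply: le_trans (ler_wpM2l (expR_ge0 _) (mgf_bounded_differences hds hF l0 lc)) _.
rewrite -expRD ler_expR le_eqVlt; apply/orP; left; apply/eqP.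
by rewrite -/N /l; field; rewrite !lt0r_neq0.
Qed.

(** * Sums of independent Bernoulli variables *)

(** Expectation of [phi] at [c] plus a sum of independent Bernoulli variables with parameters [ps];
    the accumulator [c] holds the successes so far. *)
Fixpoint bernoulli_sum {R : realType} (ps : seq R) (phi : nat -> R) (c : nat) : R :=
  if ps is p :: ps' then
    (1 - p) * bernoulli_sum ps' phi c + p * bernoulli_sum ps' phi c.+1
  else phi c.

Lemma expect_count (R : realType) (n : nat) (ds : seq {ffun 'I_n -> R})
    (i : 'I_n) (phi : nat -> R) (c : nat) :
  distributions ds ->
  expect ds (fun s => phi (c + count_mem i s)%N) =
  bernoulli_sum [seq (d : {ffun 'I_n -> R}) i | d <- ds] phi c.
Proof.
elim: ds c => [|d ds IH] c /=; first by rewrite addn0.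
move=> /distributions_cons[[_ d1] hds].
rewrite (bigD1 i) //= eqxx; under eq_expect do rewrite addnA addn1.
rewrite IH // addrC; congr (_ + _).
have -> : 1 - d i = \sum_(a < n | a != i) d a by rewrite -d1 (bigD1 i) //= addrAC subrr add0r.
rewrite mulr_suml; apply: eq_bigr => a /negbTE ai.
by rewrite -(IH c) // ai.
Qed.

Lemma eq_bernoulli_sum (R : realType) (ps : seq R) phi psi c :
  (forall k, (k <= c + size ps)%N -> phi k = psi k) ->
  bernoulli_sum ps phi c = bernoulli_sum ps psi c.
Proof.
elim: ps c => [|p ps IH] c h /=; first by apply: h; rewrite addn0.
congr (_ * _ + _ * _); apply: IH => k hk; apply: h; rewrite addnS ?ltnS //.
exact: leqW.
Qed.

Lemma bernoulli_sumB (R : realType) (ps : seq R) phi psi c :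
  bernoulli_sum ps (fun k => phi k - psi k) c =
  bernoulli_sum ps phi c - bernoulli_sum ps psi c.
Proof. by elim: ps c => [//|p ps IH] c /=; rewrite !IH; ring. Qed.

Lemma bernoulli_sumZr (R : realType) (ps : seq R) phi a c :
  bernoulli_sum ps (fun k => phi k * a) c = bernoulli_sum ps phi c * a.
Proof. by elim: ps c => [//|p ps IH] c /=; rewrite !IH; ring. Qed.

Lemma bernoulli_sum_cst (R : realType) (ps : seq R) a c :
  bernoulli_sum ps (fun=> a) c = a.
Proof. by elim: ps c => [//|p ps IH] c /=; rewrite !IH; ring. Qed.

Lemma bernoulli_sum_sum (R : realType) (ps : seq R) (I : Type) (r : seq I)
    (phi : I -> nat -> R) c :
  bernoulli_sum ps (fun k => \sum_(i <- r) phi i k) c =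
  \sum_(i <- r) bernoulli_sum ps (phi i) c.
Proof.
elim: ps c => [//|p ps IH] c /=.
by rewrite !IH !mulr_sumr -big_split.
Qed.

Lemma bernoulli_sum_shift (R : realType) (ps : seq R) phi c :
  bernoulli_sum ps (fun k => phi k.+1) c = bernoulli_sum ps phi c.+1.
Proof. by elim: ps c => [//|p ps IH] c /=; rewrite !IH. Qed.

Lemma bernoulli_sum_ge0 (R : realType) (ps : seq R) phi c :
  all (fun p => 0 <= p <= 1) ps -> (forall k, 0 <= phi k) ->
  0 <= bernoulli_sum ps phi c.
Proof.
move=> + h; elim: ps c => [//|p ps IH] c /= /andP[/andP[p0 p1] hps].
by rewrite addr_ge0 // mulr_ge0 ?IH // subr_ge0.
Qed.

Lemma bernoulli_sum_moment2 (R : realType) (ps : seq R) (a : R) c :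
  bernoulli_sum ps (fun k => (k%:R - a) ^+ 2) c =
  \sum_(p <- ps) p * (1 - p) + (c%:R + \sum_(p <- ps) p - a) ^+ 2.
Proof.
elim: ps c => [|p ps IH] c /=; first by rewrite !big_nil addr0 add0r.
by rewrite !IH !big_cons -natr1; ring.
Qed.

(** Telescoping over the exchange of one parameter at a time, as in Lindeberg's method: each
    exchange contributes [p - q] times the mean discrete derivative of [phi] at the sum of the other
    [m - 1] trials. *)
Lemma bernoulli_sum_hybrid (R : realType) (p q : R) m phi c :
  bernoulli_sum (nseq m p) phi c - bernoulli_sum (nseq m q) phi c =
  (p - q) * \sum_(r < m) bernoulli_sum (nseq r q ++ nseq (m - r.+1) p)
                           (fun k => phi k.+1 - phi k) c.
Proof.
elim: m c => [|m IH] c; first by rewrite big_ord0 mulr0 subrr.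
(* The hybrid [r = 0] has no [q] and gives the difference of the values at [c.+1] and [c]; every
   later one starts with a [q], on which it is conditioned. *)
rewrite big_ord_recl /= subn1 /= bernoulli_sumB bernoulli_sum_shift.
under eq_bigr do rewrite subSS.
rewrite big_split /= -!mulr_sumr.
move: (IH c) (IH c.+1).
set A := bernoulli_sum _ _ c; set A' := bernoulli_sum _ _ c.
set B := bernoulli_sum _ _ c.+1; set B' := bernoulli_sum _ _ c.+1.
set S := \sum_(r < m) _; set S' := \sum_(r < m) _ => h h'.
have -> : A' = A - (p - q) * S by rewrite -h; ring.
have -> : B' = B - (p - q) * S' by rewrite -h'; ring.
ring.
Qed.

Lemma cauchy_schwarz_sum (R : realType) (I : Type) (r : seq I) (a b : I -> R) :
  (\sum_(i <- r) a i * b i) ^+ 2 <=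
  (\sum_(i <- r) a i ^+ 2) * \sum_(i <- r) b i ^+ 2.
Proof.
set A := \sum_(i <- r) a i ^+ 2; set B := \sum_(i <- r) _; set C := \sum_(i <- r) _.
have C0 : 0 <= C by apply: sumr_ge0 => i _; exact: sqr_ge0.
(* Used at [x = C], [y = B]. If [C = 0] the form is linear in [y], and [y = (A + 1) / B] would make
   it negative. *)
have h x y : 0 <= x ^+ 2 * A - 2 * x * y * B + y ^+ 2 * C.
  rewrite /A /B /C !mulr_sumr -sumrB -big_split /=; apply: sumr_ge0 => i _.
  by rewrite (_ : _ + _ = (x * a i - y * b i) ^+ 2) ?sqr_ge0 //; ring.
have [C00|Cn0] := eqVneq C 0.
  have [->|B0] := eqVneq B 0; first by rewrite C00 mulr0 expr0n.
  have A0 : 0 <= A by apply: sumr_ge0 => i _; exact: sqr_ge0.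
  have := h 1 ((A + 1) / B); rewrite C00 mulr0 addr0 expr1n mul1r mulr1.
  by rewrite -mulrA divfK // leNgt => /negP[]; lra.
have Cp : 0 < C by rewrite lt_def Cn0.
have : 0 <= C * (A * C - B ^+ 2).
  by rewrite (_ : _ * _ = C ^+ 2 * A - 2 * C * B * B + B ^+ 2 * C); [exact: h|ring].
by rewrite pmulr_rge0 // subr_ge0.
Qed.

(** If [a] is the least natural number in the window, the others lie between [a] and
    [a + 2 * rho]. *)
Lemma count_window (R : realType) (m : nat) (c rho : R) : 0 <= rho ->
  \sum_(k < m) ((`|k%:R - c| <= rho)%R)%:R <= 2 * rho + 1 :> R.
Proof.
move=> rho0; pose W (k : nat) := `|k%:R - c| <= rho.
rewrite -(big_mkord predT (fun k => (W k)%:R)) /= /index_iota subn0.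
rewrite -natr_sum -big_mkcond sum1_count.
have [h|h] := boolP (has W (iota 0 m)); last first.
  have -> : count W (iota 0 m) = 0%N by apply/eqP; rewrite -leqn0 leqNgt -has_count.
  by rewrite addr_ge0 // mulr_ge0.
have ex : exists k, W k by case/hasP: h => k _ hk; exists k.
case: (ex_minnP ex) => a ha amin.
rewrite -size_filter.
apply: (@le_trans _ _ (Num.truncn (2 * rho)).+1%:R).
  rewrite ler_nat -[leqRHS](size_iota a); apply: uniq_leq_size.
    by rewrite filter_uniq // iota_uniq.
  move=> k; rewrite mem_filter mem_iota => /andP[hk _].
  rewrite mem_iota amin //= addnS ltnS -leq_subLR truncn_ge_nat ?mulr_ge0 //.
  rewrite natrB ?amin //.
  by move: ha hk; rewrite /W !ler_norml => /andP[? ?] /andP[? ?]; lra.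
by rewrite -natr1 lerD2r truncn_le // mulr_ge0.
Qed.

(** * Distance between binomial distribution functions *)

(* A sum of [m] probability mass functions, hence of total mass [m]. *)
Definition hybrid_pmf {R : realType} (m : nat) (p q : R) (k : nat) : R :=
  \sum_(r < m) bernoulli_sum (nseq r q ++ nseq (m - r.+1) p)
                 (fun j => (j == k)%:R) 0.

Definition binomial_cdf {R : realType} (m : nat) (p : R) (k : nat) : R :=
  bernoulli_sum (nseq m p) (fun j => (j <= k)%N%:R) 0.

Lemma binomial_cdf_diff (R : realType) m (p q : R) k :
  binomial_cdf m p k - binomial_cdf m q k = (q - p) * hybrid_pmf m p q k.
Proof.
rewrite /binomial_cdf bernoulli_sum_hybrid -opprB mulNr -mulrN; congr (_ * _).
rewrite -sumrN; apply: eq_bigr => r _.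
rewrite -sub0r -[X in X - _](bernoulli_sum_cst (nseq r q ++ nseq (m - r.+1) p) 0 0).
rewrite -bernoulli_sumB; apply: eq_bernoulli_sum => j _.
by case: (ltngtP j k) => h; rewrite ?subrr ?sub0r ?subr0 ?opprK.
Qed.

Lemma nseq_prob (R : realType) (r s : nat) (p q : R) :
  0 <= p <= 1 -> 0 <= q <= 1 ->
  all (fun p => 0 <= p <= 1) (nseq r q ++ nseq s p).
Proof. by move=> hp hq; rewrite all_cat !all_nseq hp hq !orbT. Qed.

Lemma hybrid_pmf_ge0 (R : realType) m (p q : R) k :
  0 <= p <= 1 -> 0 <= q <= 1 -> 0 <= hybrid_pmf m p q k.
Proof.
move=> hp hq; apply: sumr_ge0 => r _; apply: bernoulli_sum_ge0 => [|j].
  exact: nseq_prob.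
exact: ler0n.
Qed.

(** A hybrid has [m - 1] trials, so its values are below [m] and the sum over [k < m] sees all of
    its mass. *)
Lemma hybrid_pmf_sum (R : realType) m (p q : R) (g : nat -> R) :
  \sum_(k < m) hybrid_pmf m p q k * g k =
  \sum_(r < m) bernoulli_sum (nseq r q ++ nseq (m - r.+1) p) g 0.
Proof.
under eq_bigr do rewrite mulr_suml.
rewrite exchange_big /=; apply: eq_bigr => r _.
under eq_bigr do rewrite -bernoulli_sumZr.
rewrite -bernoulli_sum_sum; apply: eq_bernoulli_sum => j.
rewrite add0n size_cat !size_nseq => hj.
have jm : (j < m)%N.
  by apply: leq_ltn_trans hj _; rewrite -addSn subnKC.
rewrite (bigD1 (Ordinal jm)) //= eqxx mul1r big1 ?addr0 // => i hi.
by rewrite (_ : (j == i) = false) ?mul0r //; apply/eqP => e; move/eqP: hi; apply; apply: val_inj.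
Qed.

(** Variance plus squared bias: hybrid [r] has variance at most [r q + (m - r - 1) p], and its mean
    is [r (q - p)] away from the centre, which is the mean of the hybrid without [q]. *)
Lemma hybrid_pmf_moment2 (R : realType) m (p q : R) :
  0 <= p <= 1 -> 0 <= q <= 1 ->
  \sum_(k < m) hybrid_pmf m p q k * (k%:R - (m%:R - 1) * p) ^+ 2
    <= m%:R * (m%:R * (p + q) + m%:R ^+ 2 * (p - q) ^+ 2).
Proof.
move=> /andP[p0 p1] /andP[q0 q1].
rewrite (hybrid_pmf_sum m p q (fun k => (k%:R - (m%:R - 1) * p) ^+ 2)).
have sum_nseq (f : R -> R) r x : \sum_(y <- nseq r x) f y = r%:R * f x.
  elim: r => [|r IH] /=; first by rewrite big_nil mul0r.
  by rewrite big_cons IH -natr1; ring.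
apply: (@le_trans _ _
  (\sum_(r < m) (m%:R * (p + q) + m%:R ^+ 2 * (p - q) ^+ 2))); last first.
  by rewrite sumr_const card_ord [leRHS]mulr_natl.
apply: ler_sum => r _; rewrite bernoulli_sum_moment2 !big_cat /= !sum_nseq.
rewrite natrB // -natr1; set M : R := m%:R; set x : R := r%:R.
have x0 : 0 <= x by exact: ler0n.
have xM : x + 1 <= M by rewrite natr1 ler_nat.
apply: lerD.
  have hq : q * (1 - q) <= q by nra.
  have hp : p * (1 - p) <= p by nra.
  apply: (@le_trans _ _ (x * q + (M - (x + 1)) * p)).
    by apply: lerD; apply: ler_wpM2l => //; rewrite subr_ge0.
  by nra.
rewrite add0r (_ : _ - _ = x * (q - p)); last by ring.
rewrite exprMn -(sqrrN (q - p)) opprB ler_wpM2r ?sqr_ge0 //.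
by rewrite lerXn2r ?nnegrE //; lra.
Qed.

Lemma binomial_cdf_energy (R : realType) m (p q : R) :
  0 <= p <= 1 -> 0 <= q <= 1 ->
  m%:R ^+ 2 * (p - q) ^+ 2 <=
  12 * (1 + Num.sqrt (m%:R * (p + q)) + m%:R * `|p - q|) *
  \sum_(k < m) (binomial_cdf m p k - binomial_cdf m q k) ^+ 2.
Proof.
move=> hp hq.
have [p0 _] := andP hp; have [q0 _] := andP hq.
pose S := hybrid_pmf m p q; pose c := (m%:R - 1) * p.
set u := Num.sqrt _; set v := m%:R * `|p - q|.
have u0 : 0 <= u by exact: sqrtr_ge0.
have v0 : 0 <= v by rewrite mulr_ge0.
have uE : u ^+ 2 = m%:R * (p + q) by rewrite sqr_sqrtr // mulr_ge0 // addr_ge0.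
have vE : v ^+ 2 = m%:R ^+ 2 * (p - q) ^+ 2 by rewrite exprMn real_normK // num_real.
under eq_bigr do rewrite binomial_cdf_diff -/S exprMn.
rewrite -mulr_sumr -(sqrrN (q - p)) opprB [leRHS]mulrCA [leLHS]mulrC.
apply: ler_wpM2l; first exact: sqr_ge0.
(* Chebyshev: the second moment about [c] is at most [m (u^2 + v^2)], hence at most [m V / 2], so
   half of the mass [m] of [S] lies within [Num.sqrt V] of [c]. *)
pose V := 1 + 2 * (u ^+ 2 + v ^+ 2).
have V0 : 0 < V by rewrite /V; nra.
pose W (k : nat) : R := (`|k%:R - c| <= Num.sqrt V)%R%:R.
have W2 k : W k ^+ 2 = W k by rewrite /W; case: (_ <= _); rewrite ?expr1n ?expr0n.
have S0 k : 0 <= S k by exact: hybrid_pmf_ge0.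
have hW (k : nat) : 1 - (k%:R - c) ^+ 2 / V <= W k.
  rewrite /W; case: (leP `|_|) => h.
    by rewrite mulr1n lerBlDr lerDl divr_ge0 ?sqr_ge0 // ltW.
  rewrite mulr0n subr_le0 ler_pdivlMr // mul1r -(sqr_sqrtr (ltW V0)).
  by rewrite -(real_normK (num_real (k%:R - c))) lerXn2r ?nnegrE ?sqrtr_ge0 // ltW.
have half : m%:R / 2 <= \sum_(k < m) S k * W k.
  apply: (@le_trans _ _ (\sum_(k < m) S k * (1 - (k%:R - c) ^+ 2 / V))); last first.
    by apply: ler_sum => k _; rewrite ler_wpM2l.
  under eq_bigr do rewrite mulrBr mulr1 mulrA.
  rewrite sumrB -mulr_suml.
  have -> : \sum_(k < m) S k = m%:R.
    transitivity (\sum_(k < m) S k * 1); first by under [RHS]eq_bigr do rewrite mulr1.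
    rewrite (hybrid_pmf_sum m p q (fun=> 1)).
    under eq_bigr do rewrite bernoulli_sum_cst.
    by rewrite sumr_const card_ord.
  rewrite lerBrDr -lerBrDl ler_pdivrMr //.
  apply: le_trans (hybrid_pmf_moment2 m hp hq) _.
  rewrite -uE -vE /V; have : 0 <= m%:R :> R by []. 
  set M : R := m%:R; nra.
have cs := cauchy_schwarz_sum (index_enum 'I_m) (fun k : 'I_m => S k) (fun k : 'I_m => W k).
(* The constant 12 is this 3 times the 4 coming from [(m / 2) ^+ 2]. *)
have cw : \sum_(k < m) W k <= 3 * (1 + u + v).
  apply: le_trans (count_window m c (sqrtr_ge0 V)) _.
  have : Num.sqrt V <= 1 + 3 / 2 * u + 3 / 2 * v.
    have h0 : 0 <= 1 + 3 / 2 * u + 3 / 2 * v by nra.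
    by rewrite -[leRHS](ger0_norm h0) -sqrtr_sqr ler_wsqrtr // /V; nra.
  lra.
have SS0 : 0 <= \sum_(k < m) S k ^+ 2 by apply: sumr_ge0 => k _; exact: sqr_ge0.
have h1 : (m%:R / 2) ^+ 2 <= (\sum_(k < m) S k ^+ 2) * (3 * (1 + u + v)).
  apply: (@le_trans _ _ ((\sum_(k < m) S k * W k) ^+ 2)).
    by rewrite lerXn2r ?nnegrE ?divr_ge0 // (le_trans _ half) // divr_ge0.
  apply: le_trans cs _; under [X in _ * X <= _]eq_bigr do rewrite W2.
  by rewrite ler_wpM2l.
move: h1; set Q := \sum_(k < m) _; lra.
Qed.

(** * The closeness statistic *)

(** [u] is meant to hold [m] draws from each distribution; the value estimates without bias the
    difference of the two binomial distribution functions at [k]. *)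
Definition cdf_gap {R : realType} {n : nat} (m : nat) (i : 'I_n) (k : nat)
    (u : seq 'I_n) : R :=
  (count_mem i (take m u) <= k)%N%:R - (count_mem i (drop m u) <= k)%N%:R.

(** Multiplying the gaps of two independent blocks, instead of squaring one, makes the mean exactly
    a sum of squares. In blocks of [2 m] draws the gaps vanish for [k >= m]. *)
Definition closeness_stat {R : realType} {n : nat} (m : nat) (s : seq 'I_n) : R :=
  \sum_(i < n) \sum_(k < m)
    cdf_gap m i k (take (m + m) s) * cdf_gap m i k (drop (m + m) s).

Definition sample_block {R : realType} {n : nat} (m : nat)
    (D1 D2 : {ffun 'I_n -> R}) : seq {ffun 'I_n -> R} :=
  nseq m D1 ++ nseq m D2.

Lemma neighbours_take_drop (n m : nat) (s t : seq 'I_n) : neighbours s t ->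
  take m s = take m t /\ neighbours (drop m s) (drop m t) \/
  neighbours (take m s) (take m t) /\ drop m s = drop m t.
Proof.
move=> [s1 [a [b [s2 [-> ->]]]]]; rewrite !take_cat !drop_cat.
case: ltnP => _; first by left; split=> //; exists (drop m s1), a, b, s2.
case: (m - size s1)%N => [|k] /=; first by left; split=> //; exists [::], a, b, s2.
by right; split=> //; exists s1, a, b, (take k s2).
Qed.

(** Replacing [a] by [b] alters only the counts of [a] and [b], each by at most one, which flips the
    indicator for a single level [k]. *)
Lemma count_neighbours (R : realType) (n m : nat) (s t : seq 'I_n) :
  neighbours s t ->
  \sum_(i < n) \sum_(k < m)
     `|(count_mem i s <= k)%N%:R - (count_mem i t <= k)%N%:R| <= 2 :> R.
Proof.
move=> [s1 [a [b [s2 [-> ->]]]]].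
apply: (@le_trans _ _ (\sum_(i < n) ((a == i)%:R + (b == i)%:R))).
  apply: ler_sum => i _; rewrite !count_cat /=.
  set c := count_mem i s1; set c' := count_mem i s2.
  (* [c + c'] counts [i] outside the changed entry; it is the only level that can flip. *)
  apply: (@le_trans _ _ (\sum_(k < m)
      ((a == i)%:R + (b == i)%:R) * (k == c + c' :> nat)%N%:R)).
    apply: ler_sum => k _.
    case: (a == i); case: (b == i); rewrite ?add0n ?add1n ?addnS;
      rewrite ?subrr ?normr0 ?mulr_ge0 ?addr_ge0 ?ler0n //.
    - by rewrite addr0 mul1r; case: (ltngtP k (c + c')%N) => h;
        rewrite ?subrr ?normr0 ?sub0r ?normrN ?normr1.
    - by rewrite add0r mul1r; case: (ltngtP k (c + c')%N) => h;
        rewrite ?subrr ?normr0 ?subr0 ?normr1.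
  rewrite -mulr_sumr -[leRHS]mulr1 ler_wpM2l ?addr_ge0 ?ler0n //.
  have [h|h] := ltnP (c + c') m.
    rewrite (bigD1 (Ordinal h)) //= eqxx big1 ?addr0 // => k hk.
    by rewrite (_ : (k == _ :> nat) = false) //; apply/eqP => e; move/eqP: hk; apply; apply: val_inj.
  rewrite big1 // => k _; rewrite (_ : (k == _ :> nat) = false) //.
  by apply/eqP => e; move: (ltn_ord k); rewrite e ltnNge h.
rewrite big_split /= (bigD1 a) //= eqxx big1 ?addr0; last first.
  by move=> i /negbTE; rewrite eq_sym => ->.
rewrite (bigD1 b) //= eqxx big1 ?addr0 // => i /negbTE; by rewrite eq_sym => ->.
Qed.

Lemma cdf_gap_neighbours (R : realType) (n m : nat) (s t : seq 'I_n) :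
  neighbours s t ->
  \sum_(i < n) \sum_(k < m) `|cdf_gap m i k s - cdf_gap m i k t| <= 2 :> R.
Proof.
move=> /(neighbours_take_drop m)[[e h]|[h e]];
  apply: le_trans (count_neighbours R m h);
  apply: ler_sum => i _; apply: ler_sum => k _; rewrite /cdf_gap e.
  by rewrite opprB addrC addrA subrK distrC.
by rewrite opprB addrA subrK.
Qed.

Lemma cdf_gap_le1 (R : realType) (n m : nat) (i : 'I_n) k s :
  `|cdf_gap m i k s| <= 1 :> R.
Proof.
rewrite /cdf_gap; case: (_ <= k)%N; case: (_ <= k)%N;
  by rewrite ?subrr ?subr0 ?sub0r ?normrN ?normr0 ?normr1.
Qed.

(** The statistic is bilinear in the gaps of its two blocks. One draw affects one block, whose gaps
    move by at most 2 in total, and their cofactors are bounded by 1. *)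
Lemma closeness_stat_bounded (R : realType) (n m : nat) :
  bounded_differences (2 : R) (closeness_stat (n := n) m).
Proof.
move=> s t /(neighbours_take_drop (m + m))[[e h]|[h e]];
  apply: le_trans (cdf_gap_neighbours R m h);
  rewrite /closeness_stat e -sumrB; apply: le_trans (ler_norm_sum _ _ _) _;
  apply: ler_sum => i _; rewrite -sumrB; apply: le_trans (ler_norm_sum _ _ _) _;
  apply: ler_sum => k _; rewrite -?mulrBr -?mulrBl normrM.
  by rewrite ler_piMl // cdf_gap_le1.
by rewrite ler_piMr // cdf_gap_le1.
Qed.

Lemma distributions_block (R : realType) (n m : nat) (D1 D2 : {ffun 'I_n -> R}) :
  is_distribution D1 -> is_distribution D2 ->
  distributions (sample_block m D1 D2).
Proof. by move=> h1 h2; apply: distributions_cat; apply: distributions_nseq. Qed.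

Lemma size_block (R : realType) (n m : nat) (D1 D2 : {ffun 'I_n -> R}) :
  size (sample_block m D1 D2) = (m + m)%N.
Proof. by rewrite size_cat !size_nseq. Qed.

Lemma expect_cdf_gap (R : realType) (n m : nat) (D1 D2 : {ffun 'I_n -> R}) i k :
  is_distribution D1 -> is_distribution D2 ->
  expect (sample_block m D1 D2) (cdf_gap m i k) =
  binomial_cdf m (D1 i) k - binomial_cdf m (D2 i) k.
Proof.
move=> h1 h2; rewrite expect_cat.
have d1 : distributions (nseq m D1) by exact: distributions_nseq.
have d2 : distributions (nseq m D2) by exact: distributions_nseq.
have cdfE (D : {ffun 'I_n -> R}) : distributions (nseq m D) ->
    expect (nseq m D) (fun s => (count_mem i s <= k)%N%:R) = binomial_cdf m (D i) k.
  move=> hd; rewrite /binomial_cdf.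
  have -> : nseq m (D i) = [seq (D' : {ffun 'I_n -> R}) i | D' <- nseq m D] by rewrite map_nseq.
  by rewrite -(expect_count i (fun j => (j <= k)%N%:R) 0 hd).
rewrite -(cdfE _ d1) -(cdfE _ d2) -[X in _ = _ - X](expect_cst _ d1) -expectB.
apply: eq_expect => s; rewrite size_nseq => hs.
rewrite -[X in _ = X - _](expect_cst _ d2) -expectB; apply: eq_expect => t _.
by rewrite /cdf_gap -hs take_size_cat // drop_size_cat.
Qed.

Lemma expect_closeness_stat (R : realType) (n m : nat) (D1 D2 : {ffun 'I_n -> R}) :
  is_distribution D1 -> is_distribution D2 ->
  expect (sample_block m D1 D2 ++ sample_block m D1 D2) (closeness_stat m) =
  \sum_(i < n) \sum_(k < m)
    (binomial_cdf m (D1 i) k - binomial_cdf m (D2 i) k) ^+ 2.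
Proof.
move=> h1 h2; have hd := distributions_block (m := m) h1 h2; rewrite expect_cat.
transitivity (expect (sample_block m D1 D2) (fun s => \sum_(i < n) \sum_(k < m)
    expect (sample_block m D1 D2) (cdf_gap m i k) * cdf_gap m i k s)).
  apply: eq_expect => s; rewrite size_block => hs.
  rewrite /closeness_stat.
  under eq_expect do rewrite take_size_cat // drop_size_cat //.
  rewrite expect_sum //; apply: eq_bigr => i _.
  rewrite expect_sum //; apply: eq_bigr => k _.
  by rewrite expectZ mulrC.
rewrite expect_sum //; apply: eq_bigr => i _.
rewrite expect_sum //; apply: eq_bigr => k _.
by rewrite expectZ expect_cdf_gap // expr2.
Qed.

Lemma distribution_le1 (R : realType) (n : nat) (D : {ffun 'I_n -> R}) i :
  is_distribution D -> 0 <= D i <= 1.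
Proof.
move=> [D0 D1]; rewrite D0 -D1 (bigD1 i) //= lerDl.
by apply: sumr_ge0 => j _.
Qed.

Lemma closeness_stat_lower (R : realType) (n m : nat) (D1 D2 : {ffun 'I_n -> R}) :
  is_distribution D1 -> is_distribution D2 ->
  m%:R ^+ 2 * TV D1 D2 ^+ 2 <=
  3 * (n%:R + Num.sqrt (2 * n%:R * m%:R) + 2 * m%:R * TV D1 D2) *
  expect (sample_block m D1 D2 ++ sample_block m D1 D2) (closeness_stat m).
Proof.
move=> h1 h2; rewrite expect_closeness_stat //; set U := (X in 3 * X).
pose e i := \sum_(k < m) (binomial_cdf m (D1 i) k - binomial_cdf m (D2 i) k) ^+ 2.
rewrite -[X in _ <= _ * X]/(\sum_(i < n) e i).
pose w i := 1 + Num.sqrt (m%:R * (D1 i + D2 i)) + m%:R * `|D1 i - D2 i|.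
have hw i : m%:R ^+ 2 * (D1 i - D2 i) ^+ 2 <= 12 * w i * e i.
  by apply: binomial_cdf_energy; apply: distribution_le1.
have w0 i : 0 < w i by rewrite /w -addrA ltr_pwDl // addr_ge0 ?sqrtr_ge0 // mulr_ge0.
have sumE : \sum_(i < n) `|D1 i - D2 i| = 2 * TV D1 D2.
  by rewrite /TV mulrA divff ?mul1r // pnatr_eq0.
have hW : \sum_(i < n) w i <= U.
  rewrite /U /w !big_split /= -mulr_sumr sumE sumr_const card_ord mulrA [m%:R * 2]mulrC.
  rewrite lerD2r lerD2l.
  rewrite -[leLHS]ger0_norm; last by apply: sumr_ge0 => i _; exact: sqrtr_ge0.
  rewrite -sqrtr_sqr ler_wsqrtr //.
  (* Cauchy-Schwarz against the constant 1: the [n] roots have squares summing to [2 m]. *)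
  under eq_bigr do rewrite -[Num.sqrt _]mulr1.
  apply: le_trans (cauchy_schwarz_sum _ _ _) _.
  under eq_bigr => i _.
    rewrite sqr_sqrtr; last first.
      by rewrite mulr_ge0 // addr_ge0 //; [case: h1|case: h2].
    over.
  rewrite -mulr_sumr big_split /= (proj2 h1) (proj2 h2).
  under [X in _ * X]eq_bigr do rewrite expr1n.
  rewrite sumr_const card_ord.
  by rewrite le_eqVlt; apply/orP; left; apply/eqP; ring.
(* The weights [w i] make the first factor comparable with the [e i] through [hw]. As the distances
   sum to [2 * TV D1 D2], the factor 12 becomes 3. *)
have cs := cauchy_schwarz_sum (index_enum 'I_n)
  (fun i => `|D1 i - D2 i| / Num.sqrt (w i)) (fun i => Num.sqrt (w i)).
have E0 : 0 <= \sum_(i < n) e i.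
  by apply: sumr_ge0 => i _; apply: sumr_ge0 => k _; exact: sqr_ge0.
have : m%:R ^+ 2 * (2 * TV D1 D2) ^+ 2 <= 12 * (\sum_(i < n) e i) * \sum_(i < n) w i.
  rewrite -sumE.
  have -> : \sum_(i < n) `|D1 i - D2 i| =
      \sum_(i < n) `|D1 i - D2 i| / Num.sqrt (w i) * Num.sqrt (w i).
    by apply: eq_bigr => i _; rewrite divfK // gt_eqF // sqrtr_gt0.
  apply: le_trans (ler_wpM2l (sqr_ge0 _) cs) _; rewrite mulrA.
  under [X in _ * X <= _]eq_bigr do rewrite sqr_sqrtr ?(ltW (w0 _)) //.
  apply: ler_wpM2r; first by apply: sumr_ge0 => i _; exact: ltW.
  rewrite !mulr_sumr; apply: ler_sum => i _.
  rewrite exprMn exprVn sqr_sqrtr ?(ltW (w0 _)) // mulrA ler_pdivrMr //.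
  by rewrite real_normK ?num_real // (le_trans (hw i)) // le_eqVlt; apply/orP; left; apply/eqP; ring.
set W := \sum_(i < n) w i in hW *; set E := \sum_(i < n) e i in E0 *.
set T := TV D1 D2 => h.
have : E * W <= E * U by rewrite ler_wpM2l.
lra.
Qed.

(** * From streams to finite sequences of samples *)

(** With [c = 2] and [4 m] samples the denominator of the tail bound is [8 * 4 * 4 m = 128 m],
    whence the threshold; [L <= 2 m] is the condition [t <= 2 * c * N]. The sign covers both
    tails. *)
Lemma closeness_stat_tail (R : realType) (n m : nat)
    (ds : seq {ffun 'I_n -> R}) (L : R) (b : bool) :
  distributions ds -> size ds = (4 * m)%N -> (0 < m)%N -> 0 <= L ->
  L <= 2 * m%:R ->
  expect ds (fun s => (Num.sqrt (128 * m%:R * L) <=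
     (-1) ^+ b * (closeness_stat m s - expect ds (closeness_stat m)))%R%:R)
    <= expR (- L).
Proof.
move=> hds hsz m0 L0 hL.
have M0 : 0 < m%:R :> R by rewrite ltr0n.
pose F (s : seq 'I_n) : R := (-1) ^+ b * closeness_stat m s.
have hF : bounded_differences 2 F.
  by move=> s t /(closeness_stat_bounded R m); rewrite /F -mulrBr normrMsign.
have T0 : 0 <= 128 * m%:R * L by rewrite !mulr_ge0.
have := @bounded_differences_tail _ _ ds F 2 (Num.sqrt (128 * m%:R * L)) hds hF.
rewrite hsz natrM sqr_sqrtr // => tail.
rewrite (@eq_expect _ _ ds _
  (fun s => (Num.sqrt (128 * m%:R * L) <= F s - expect ds F)%R%:R)); last first.
  by move=> s _; rewrite /F expectZ mulrBr.
apply: le_trans (tail _ _ _ _) _ => //.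
- by rewrite muln_gt0.
- have h0 : 0 <= 2 * 2 * (4 * m%:R) :> R by lra.
  by rewrite -[leRHS](ger0_norm h0) -sqrtr_sqr ler_wsqrtr //; nra.
rewrite ler_expR le_eqVlt; apply/orP; left; apply/eqP; field.
by rewrite lt0r_neq0.
Qed.

Lemma measurable_joint (d : measure_display) (Omega : measurableType d)
    (I : Type) (n : nat) (Z : I -> Omega -> 'I_n) (J : seq I) (Q : pred (seq 'I_n)) :
  (forall j (B : set 'I_n), measurable (Z j @^-1` B)) ->
  measurable [set w | Q [seq Z j w | j <- J]].
Proof.
move=> hZ; elim: J Q => [|j J IH] Q /=.
  case: (Q [::]).
    by rewrite (_ : mkset _ = setT) //; apply/seteqP.
  rewrite (_ : mkset _ = set0); first exact: measurable0.
  by apply/seteqP; split=> w.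
rewrite (_ : mkset _ = \bigcup_(a in [set: 'I_n])
   (Z j @^-1` [set a] `&` [set w | Q (a :: [seq Z j w | j <- J])])).
  apply: fin_bigcup_measurable => // a _; apply: measurableI => //.
  exact: (IH (fun s => Q (a :: s))).
apply/seteqP; split=> w /=; first by move=> h; exists (Z j w).
by move=> [a _ [/= <-]].
Qed.

(** Generalised for the induction on [J]: its head moves into the pinned list [K], with one disjoint
    case for each value [a]. Once [J] is empty, the product rule of independence applies. *)
Lemma probability_joint_pinned (R : realType) (d : measure_display)
    (Omega : measurableType d) (P : probability Omega R) (I : eqType) (n : nat)
    (Z : I -> Omega -> 'I_n) (law : I -> {ffun 'I_n -> R}) :
  (forall j (B : set 'I_n), measurable (Z j @^-1` B)) ->
  (forall j a, P (Z j @^-1` [set a]) = (law j a)%:E) ->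
  mutually_independent P Z ->
  forall (J K : seq I) (v : I -> 'I_n) (Q : pred (seq 'I_n)), uniq (K ++ J) ->
  P ([set w | forall j, j \in K -> Z j w = v j] `&`
     [set w | Q [seq Z j w | j <- J]]) =
  (\prod_(j <- K) law j (v j) *
   expect [seq law j | j <- J] (fun s => (Q s)%:R))%:E.
Proof.
move=> mZ hlaw indep; elim=> [|j J IH] K v Q uKJ /=.
  rewrite cats0 in uKJ; case: (Q [::]); last first.
    by rewrite mulr0n mulr0 (_ : _ `&` _ = set0) ?measure0 //; apply/seteqP; split=> w [].
  rewrite mulr1n mulr1 (_ : [set _ | true] = setT) ?setIT; last exact/seteqP.
  rewrite -prodEFin; under [RHS]eq_bigr do rewrite -hlaw.
  exact: (indep K (fun j => [set v j])).
pose v' (a : 'I_n) (i : I) := if i == j then a else v i.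
pose S a := [set w | forall i, i \in rcons K j -> Z i w = v' a i] `&`
            [set w | Q (a :: [seq Z i w | i <- J])].
have jK : j \notin K.
  by move: uKJ; rewrite cat_uniq /= => /and3P[_ /norP[]].
have v'j a : v' a j = a by rewrite /v' eqxx.
have v'K a i : i \in K -> v' a i = v i.
  by move=> iK; rewrite /v'; case: eqP => // e; rewrite -e iK in jK.
have inj w a : S a w -> Z j w = a.
  by move=> [/(_ j)]; rewrite mem_rcons mem_head v'j => h _; apply: h.
rewrite (_ : _ `&` _ = \big[setU/set0]_(a < n) S a); last first.
  rewrite -bigcup_seq; apply/seteqP; split=> w.
    move=> [/= hK hQ]; exists (Z j w); first by rewrite /= mem_index_enum.
    split=> //= i; rewrite mem_rcons in_cons => /orP[/eqP->|iK]; first by rewrite v'j.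
    by rewrite v'K // hK.
  move=> [a _ Sa]; have ja := inj _ _ Sa; case: Sa => /= hK hQ.
  split=> /=; last by rewrite ja.
  by move=> i iK; rewrite hK ?v'K // mem_rcons in_cons iK orbT.
(* The pinned values become a boolean test on the list of samples; the default [a] of [nth] is never
   reached. *)
have mS a : measurable (S a).
  rewrite (_ : S a = [set w | [forall i : 'I_(size K).+1,
      nth a [seq Z i w | i <- rcons K j] i == nth a [seq v' a i | i <- rcons K j] i]]
      `&` [set w | Q (a :: [seq Z i w | i <- J])]).
    apply: measurableI; last exact: (measurable_joint J (fun s => Q (a :: s)) mZ).
    exact: (measurable_joint (rcons K j) (fun s => [forall i : 'I_(size K).+1,
      nth a s i == nth a [seq v' a i | i <- rcons K j] i]) mZ).
  congr (_ `&` _); apply/seteqP; split=> w /=.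
    move=> h; apply/forallP => i.
    rewrite !(nth_map j) ?size_rcons //; apply/eqP/h.
    by rewrite mem_nth // size_rcons.
  move=> /forallP h i iK.
  have si : (index i (rcons K j) < (size K).+1)%N by rewrite -(size_rcons K j) index_mem.
  have /eqP := h (Ordinal si); rewrite /= !(nth_map j) ?size_rcons //.
  by rewrite nth_index.
rewrite measure_bigsetU_ord //; last first.
  by move=> a b _ _ [w [/inj <- /inj]].
rewrite mulr_sumr -sumEFin; apply: eq_bigr => a _.
apply: (etrans (IH (rcons K j) (v' a) (fun s => Q (a :: s)) _)).
  by rewrite cat_rcons.
rewrite big_rcons /= v'j mulrA; congr (_ * _)%:E.
by congr (_ * _); apply: eq_big_seq => i iK; rewrite v'K.
Qed.

Lemma probability_joint (R : realType) (d : measure_display)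
    (Omega : measurableType d) (P : probability Omega R) (I : eqType) (n : nat)
    (Z : I -> Omega -> 'I_n) (law : I -> {ffun 'I_n -> R})
    (J : seq I) (Q : pred (seq 'I_n)) :
  (forall j (B : set 'I_n), measurable (Z j @^-1` B)) ->
  (forall j a, P (Z j @^-1` [set a]) = (law j a)%:E) ->
  mutually_independent P Z -> uniq J -> (0 < n)%N ->
  P [set w | Q [seq Z j w | j <- J]] =
  (expect [seq law j | j <- J] (fun s => (Q s)%:R))%:E.
Proof.
move=> mZ hlaw indep uJ n0.
have := probability_joint_pinned mZ hlaw indep (J := J) (K := [::])
  (fun=> Ordinal n0) Q uJ.
rewrite big_nil mul1r => <-; congr (P _).
by apply/seteqP; split=> w // [].
Qed.

(** * Stage sizes and the sample rate *)

(** Logarithm of the inverse of the error allotted to stage [j]; these errors telescope to a total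
    of 1/10. *)
Definition confidence {R : realType} (j : nat) : R := ln (10 * (j.+1%:R * j.+2%:R)).

(* [64 ^ 2 * 128]: what the third term of the denominator needs in [stage_gap]. *)
Definition stage_const {R : realType} : R := 2 ^+ 19.

(** With [e = 2^-j] and [L = confidence j]: up to constants [m] exceeds [L / e^2],
    [n^(1/2) L^(1/2) / e^2] and [n^(2/3) L^(1/3) / e^(4/3)], written without roots. *)
Definition stage_ok {R : realType} (n j m : nat) : bool :=
  [&& stage_const * confidence j <= m%:R * ((2^-1) ^+ j) ^+ 2 :> R,
      stage_const * n%:R * confidence j <= m%:R ^+ 2 * ((2^-1) ^+ j) ^+ 4 :> R &
      stage_const * n%:R ^+ 2 * confidence j <= m%:R ^+ 3 * ((2^-1) ^+ j) ^+ 4 :> R].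

Lemma expR1_le4 (R : realType) : expR 1 <= 4 :> R.
Proof.
have -> : 1 = 2^-1 + 2^-1 :> R by lra.
rewrite expRD; have h := @expR_quadratic R 2^-1 (lexx _).
have h0 := expR_ge0 (2^-1 : R); nra.
Qed.

Lemma confidence_arg_gt0 (R : realType) j : 0 < 10 * (j.+1%:R * j.+2%:R) :> R.
Proof. by rewrite !mulr_gt0 // ltr0n. Qed.

Lemma confidence_ge1 (R : realType) j : 1 <= confidence j :> R.
Proof.
rewrite -ler_expR lnK ?posrE ?confidence_arg_gt0 //.
apply: le_trans (expR1_le4 R) _.
have h1 : 1 <= j.+1%:R :> R by rewrite ler1n.
have h2 : 1 <= j.+2%:R :> R by rewrite ler1n.
nra.
Qed.

Lemma half_pow_gt0 (R : realType) j : 0 < (2^-1) ^+ j :> R.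
Proof. by rewrite exprn_gt0 // invr_gt0. Qed.

Lemma half_pow_le1 (R : realType) j : (2^-1) ^+ j <= 1 :> R.
Proof. by rewrite exprn_ile1 // ?invr_ge0 // invf_le1 // ler1n. Qed.

Lemma stage_const_ge (R : realType) k : (k <= 19)%N -> 2 ^+ k <= stage_const :> R.
Proof. by move=> hk; rewrite ler_eXn2l // ltr1n. Qed.

Lemma stage_const_ge1 (R : realType) : 1 <= stage_const :> R.
Proof. exact: (@stage_const_ge R 0). Qed.

Lemma stage_exists (R : realType) n j : exists m, stage_ok (R := R) n j m.
Proof.
rewrite /stage_ok; set e : R := (2^-1) ^+ j.
have e0 : 0 < e := half_pow_gt0 R j; have e1 : e <= 1 := half_pow_le1 R j.
have := stage_const_ge1 R; move: stage_const => K K1.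
set L : R := confidence j; have L1 : 1 <= L := confidence_ge1 R j.
(* One crude size meets all three requirements, since [1], [n] and [n^2] are at most [n^2 + 1],
   [e <= 1] and [M >= 1]. *)
pose x : R := K * (n%:R ^+ 2 + 1) * L / e ^+ 4.
have e4 : 0 < e ^+ 4 by rewrite exprn_gt0.
have e41 : e ^+ 4 <= 1 by rewrite exprn_ile1 // ltW.
have N0 : 0 <= n%:R :> R by [].
have K0 : 0 <= K := le_trans ler01 K1.
have L0 : 0 <= L := le_trans ler01 L1.
have N2 : 0 <= n%:R ^+ 2 :> R by exact: sqr_ge0.
have N21 : 1 <= n%:R ^+ 2 + 1 :> R by rewrite lerDr.
have x1 : 1 <= x.
  rewrite /x ler_pdivlMr // mul1r (le_trans e41) //.
  by rewrite !mulr_ege1.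
exists (Num.truncn x).+1; set M : R := (Num.truncn x).+1%:R.
have xM : x <= M by rewrite /M ltW // truncnS_gt.
have M1 : 1 <= M by exact: le_trans xM.
have hM : K * (n%:R ^+ 2 + 1) * L <= M * e ^+ 4.
  by rewrite -ler_pdivrMr.
have e42 : e ^+ 4 <= e ^+ 2.
  by rewrite (exprD e 2 2) ler_piMl ?sqr_ge0 // exprn_ile1 // ltW.
have M2 : M <= M ^+ 2 by rewrite expr2 ler_peMl //; lra.
have M3 : M <= M ^+ 3.
  by apply: le_trans M2 _; rewrite (exprS M 2) ler_peMl ?sqr_ge0.
have a2 : M * e ^+ 4 <= M ^+ 2 * e ^+ 4 by rewrite ler_wpM2r // ltW.
have a3 : M * e ^+ 4 <= M ^+ 3 * e ^+ 4 by rewrite ler_wpM2r // ltW.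
have a1 : M * e ^+ 4 <= M * e ^+ 2 by rewrite ler_wpM2l //; lra.
have NL (y : R) : y <= n%:R ^+ 2 + 1 ->
    K * y * L <= K * (n%:R ^+ 2 + 1) * L.
  by move=> hy; rewrite ler_wpM2r // ler_wpM2l.
have h2 : n%:R <= n%:R ^+ 2 + 1 :> R by clear - N0; nra.
have h3 : n%:R ^+ 2 <= n%:R ^+ 2 + 1 :> R by rewrite lerDl.
apply/and3P; split.
- by have := NL _ N21; rewrite mulr1 => /le_trans; apply; rewrite (le_trans hM).
- by apply: le_trans (NL _ h2) _; rewrite (le_trans hM).
- by apply: le_trans (NL _ h3) _; rewrite (le_trans hM).
Qed.

(** The least admissible size, so that an admissible size of the order of the rate bounds it from
    above. *)
Definition stage_size (R : realType) (n j : nat) : nat := ex_minn (stage_exists R n j).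

Lemma stage_size_ok (R : realType) n j : stage_ok (R := R) n j (stage_size R n j).
Proof. by rewrite /stage_size; case: ex_minnP. Qed.

Lemma stage_size_le (R : realType) n j m :
  stage_ok (R := R) n j m -> (stage_size R n j <= m)%N.
Proof. by rewrite /stage_size; case: ex_minnP => m' _ h /h. Qed.

(** The first bound ensures that the rule examines stage [j] by time [2 m]; the second is what
    [closeness_stat_tail] requires. *)
Lemma stage_ok_large (R : realType) n j m : stage_ok (R := R) n j m ->
  (j < m)%N /\ confidence j <= 2 * m%:R :> R.
Proof.
move=> /and3P[+ _ _]; set e : R := (2^-1) ^+ j; set L : R := confidence j.
have e0 : 0 < e := half_pow_gt0 R j; have e1 : e <= 1 := half_pow_le1 R j.
have L1 : 1 <= L := confidence_ge1 R j.
have M0 : 0 <= m%:R :> R by [].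
move=> h; have e2 : e ^+ 2 <= e by rewrite expr2 ler_piMl // ltW.
have h1 : m%:R * e ^+ 2 <= m%:R * e by rewrite ler_wpM2l.
have h2 : m%:R * e <= m%:R by rewrite ler_piMr.
have KL : L <= stage_const * L by rewrite ler_peMl ?stage_const_ge1 // (le_trans ler01).
have LM : L <= m%:R * e by rewrite (le_trans KL) // (le_trans h).
split.
  2: by rewrite (le_trans LM) // (le_trans h2) // ler_peMl // ler1n.
rewrite -(ltr_nat R); apply: (@lt_le_trans _ _ (2 ^+ j)).
  by rewrite -natrX ltr_nat ltn_expl.
have ee : 2 ^+ j * e = 1 by rewrite -exprMn divff ?expr1n // pnatr_eq0.
by rewrite -(ler_pM2r e0) ee (le_trans L1).
Qed.

(* The three requirements of [stage_ok] control the three terms of the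
   denominator in [closeness_stat_lower]. *)
Lemma stage_gap (R : realType) n j m (d E : R) : (0 < n)%N ->
  stage_ok (R := R) n j m -> (2^-1) ^+ j <= d ->
  m%:R ^+ 2 * d ^+ 2 <= 3 * (n%:R + Num.sqrt (2 * n%:R * m%:R) + 2 * m%:R * d) * E ->
  2 * Num.sqrt (128 * m%:R * confidence j) <= E.
Proof.
move=> n0 ok ed hE; have [jm _] := stage_ok_large ok.
have kc k := @stage_const_ge R k.
move: ok; rewrite /stage_ok => /and3P[]; move: stage_const kc => K kc; set e : R := (2^-1) ^+ j in ed *; set L : R := confidence j.
have e0 : 0 < e := half_pow_gt0 R j.
have L1 : 1 <= L := confidence_ge1 R j.
have d0 : 0 < d := lt_le_trans e0 ed.
have M0 : 0 < m%:R :> R by rewrite ltr0n (leq_ltn_trans _ jm).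
have N1 : 1 <= n%:R :> R by rewrite ler1n.
move: hE; set M : R := m%:R; set N : R := n%:R in N1 *; set q := Num.sqrt (2 * N * M).
move=> hE k1 k2 k3.
have q0 : 0 <= q by exact: sqrtr_ge0.
have qE : q ^+ 2 = 2 * N * M by rewrite sqr_sqrtr // !mulr_ge0 //; lra.
set t := Num.sqrt _.
have L0 : 0 <= L := le_trans ler01 L1.
have N0 : 0 <= N := le_trans ler01 N1.
have t0 : 0 <= t by exact: sqrtr_ge0.
have tE : t ^+ 2 = 128 * M * L by rewrite sqr_sqrtr // !mulr_ge0 // ltW.
have d2 : e ^+ 2 <= d ^+ 2 by rewrite lerXn2r ?nnegrE // ltW.
have d4 : e ^+ 4 <= d ^+ 4 by rewrite lerXn2r ?nnegrE // ltW.
have c1 : K * L <= M * d ^+ 2.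
  by apply: le_trans k1 _; rewrite ler_wpM2l // ltW.
have c2 : K * N * L <= M ^+ 2 * d ^+ 4.
  by apply: le_trans k2 _; rewrite ler_wpM2l // sqr_ge0.
have c3 : K * N ^+ 2 * L <= M ^+ 3 * d ^+ 4.
  by apply: le_trans k3 _; rewrite ler_wpM2l // exprn_ge0 // ltW.
have md0 : 0 <= M ^+ 2 * d ^+ 2 by rewrite mulr_ge0 ?sqr_ge0.
have sq_le (x y : R) : 0 <= x -> 0 <= y -> x ^+ 2 <= y ^+ 2 -> x <= y.
  by move=> x0 y0; rewrite ler_sqr.
(* Each term of the denominator times [32 * t] is at most [M ^+ 2 * d ^+ 2]. Squaring removes the
   roots and asks for [K] at least [2 ^+ 17], [2 ^+ 18] and [2 ^+ 19] in turn. *)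
have f1 : 32 * (t * N) <= M ^+ 2 * d ^+ 2.
  apply: sq_le => //; first by rewrite !mulr_ge0.
  rewrite (_ : (M ^+ 2 * d ^+ 2) ^+ 2 = M * (M ^+ 3 * d ^+ 4)); last by ring.
  rewrite !exprMn tE (_ : 32 ^+ 2 * _ = M * (2 ^+ 17 * N ^+ 2 * L)); last by ring.
  rewrite ler_wpM2l ?(ltW M0) //; apply: le_trans c3.
  by rewrite !ler_wpM2r ?sqr_ge0 // kc.
have f2 : 32 * (t * q) <= M ^+ 2 * d ^+ 2.
  apply: sq_le => //; first by rewrite !mulr_ge0.
  rewrite (_ : (M ^+ 2 * d ^+ 2) ^+ 2 = M ^+ 2 * (M ^+ 2 * d ^+ 4)); last by ring.
  rewrite !exprMn tE qE (_ : 32 ^+ 2 * _ = M ^+ 2 * (2 ^+ 18 * N * L)); last by ring.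
  rewrite ler_wpM2l ?sqr_ge0 //; apply: le_trans c2.
  by rewrite !ler_wpM2r // kc.
have f3 : 32 * (t * (2 * M * d)) <= M ^+ 2 * d ^+ 2.
  have h : 64 * t <= M * d.
    apply: sq_le; [by rewrite mulr_ge0|by rewrite mulr_ge0 // ltW|].
    rewrite (_ : (M * d) ^+ 2 = M * (M * d ^+ 2)); last by ring.
    rewrite !exprMn tE (_ : 64 ^+ 2 * _ = M * (2 ^+ 19 * L)); last by ring.
    rewrite ler_wpM2l ?(ltW M0) //; apply: le_trans c1.
    by rewrite ler_wpM2r // kc.
  rewrite (_ : 32 * _ = M * d * (64 * t)); last by ring.
  rewrite (_ : M ^+ 2 * _ = M * d * (M * d)); last by ring.
  by rewrite ler_wpM2l // mulr_ge0 // ltW.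
have W0 : 0 < 3 * (N + q + 2 * M * d).
  by rewrite mulr_gt0 // ltr_wpDr ?mulr_ge0 ?(ltW M0) ?(ltW d0) // ltr_wpDr // (lt_le_trans ltr01).
rewrite -(ler_pM2l W0); apply: le_trans hE.
(* The three bounds add up to the factor [3 * 6 / 32], which is below 1. *)
rewrite (_ : _ * (2 * t) =
  (6 / 32) * (32 * (t * N) + 32 * (t * q) + 32 * (t * (2 * M * d)))); last by clear; field.
have A0 : 0 <= M ^+ 2 * d ^+ 2 := md0.
move: (32 * (t * N)) (32 * (t * q)) (32 * _) (M ^+ 2 * _) f1 f2 f3 A0 => a b c z.
clear; lra.
Qed.

(** * Comparison of the stage size with the sample rate *)

Lemma powR_div_exp (R : realType) (a : R) (k l : nat) : 0 <= a -> (0 < l)%N ->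
  (a `^ (k%:R / l%:R)) ^+ l = a ^+ k.
Proof.
move=> a0 l0; rewrite -powR_mulrn ?powR_ge0 // -powRrM divfK ?powR_mulrn //.
by rewrite pnatr_eq0 -lt0n.
Qed.

Lemma loglog_inv_ge1 (R : realType) (d : R) : 1 <= loglog_inv d.
Proof. by rewrite /loglog_inv le_max lexx. Qed.

(** [176 = 11 * 16]: 11 passes from [confidence j] to [loglog_inv d], and 16 pays for
    [d ^+ 4 <= 16 * e ^+ 4]. Cubing and squaring remove the fractional powers; the constant, at
    least 1, only grows. *)
Lemma stage_ok_rate (R : realType) n j m (d : R) :
  0 < d -> d <= 2 * (2^-1) ^+ j -> confidence j <= 11 * loglog_inv d ->
  176 * stage_const * sample_rate n d <= m%:R -> stage_ok (R := R) n j m.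
Proof.
move=> d0 de hL hm; rewrite /stage_ok.
move: hL hm; rewrite /sample_rate; set l := loglog_inv d; set L := confidence j.
set e := (2^-1) ^+ j in de *.
have := stage_const_ge1 R; move: stage_const => K K1.
have l1 : 1 <= l := loglog_inv_ge1 d.
have C0 : 0 <= 176 * K by rewrite mulr_ge0 // (le_trans ler01).
move=> hL; rewrite !maxr_pMr // !ge_max => /and3P[].
set N : R := n%:R; set M : R := m%:R => k1 k2 k3.
have N0 : 0 <= N by rewrite /N.
have l0 : 0 <= l by lra.
have e0 : 0 < e := half_pow_gt0 R j.
have d2 : d ^+ 2 <= 4 * e ^+ 2.
  rewrite (_ : 4 * _ = (2 * e) ^+ 2); last by ring.
  by rewrite lerXn2r ?nnegrE // ?(ltW d0) // mulr_ge0 // ltW.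
have d4 : d ^+ 4 <= 16 * e ^+ 4.
  rewrite (_ : 16 * _ = (2 * e) ^+ 4); last by ring.
  by rewrite lerXn2r ?nnegrE // ?(ltW d0) // mulr_ge0 // ltW.
have M0 : 0 <= M by rewrite /M.
have C1 : 1 <= 176 * K by rewrite mulr_ege1 // ler1n.
have c1 : 176 * K * l <= M * d ^+ 2.
  by move: k1; rewrite mulrA ler_pdivrMr ?exprn_gt0.
have c2 : 176 * K * (N ^+ 2 * l) <= M ^+ 3 * d ^+ 4.
  have h : (176 * K * (N `^ (2 / 3) * l `^ (1 / 3) / d `^ (4 / 3))) ^+ 3 <= M ^+ 3.
    by rewrite lerXn2r ?nnegrE // !mulr_ge0 ?invr_ge0 ?powR_ge0 ?(le_trans ler01 K1).
  move: h; rewrite !exprMn exprVn.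
  rewrite (powR_div_exp 2 N0) // (powR_div_exp 1 l0) // (powR_div_exp 4 (ltW d0)) //.
  rewrite expr1 mulrA ler_pdivrMr ?exprn_gt0 // => h.
  apply: le_trans h; rewrite ler_wpM2r //; first by rewrite mulr_ge0 ?sqr_ge0.
  by rewrite -exprMn ler_eXnr.
have c3 : 176 * K * (N * l) <= M ^+ 2 * d ^+ 4.
  have h : (176 * K * (N `^ (1 / 2) * l `^ (1 / 2) / d ^+ 2)) ^+ 2 <= M ^+ 2.
    by rewrite lerXn2r ?nnegrE // !mulr_ge0 ?invr_ge0 ?powR_ge0 ?sqr_ge0 ?(le_trans ler01 K1).
  move: h; rewrite !exprMn exprVn.
  rewrite (powR_div_exp 1 N0) // (powR_div_exp 1 l0) // -exprM.
  rewrite !expr1 mulrA ler_pdivrMr ?exprn_gt0 // => h.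
  apply: le_trans h; rewrite ler_wpM2r //; first by rewrite mulr_ge0.
  by rewrite -exprMn ler_eXnr.
have M2 : 0 <= M ^+ 2 by exact: sqr_ge0.
have M3 : 0 <= M ^+ 3 by exact: exprn_ge0.
have g1 := ler_wpM2l M0 d2; have g2 := ler_wpM2l M2 d4; have g3 := ler_wpM2l M3 d4.
have K0 : 0 <= K := le_trans ler01 K1.
have N2 : 0 <= N ^+ 2 by exact: sqr_ge0.
have h1 := ler_wpM2l K0 hL.
have h2 := ler_wpM2l (mulr_ge0 K0 N0) hL.
have h3 := ler_wpM2l (mulr_ge0 K0 N2) hL.
have p1 := mulr_ge0 K0 l0.
have p2 := mulr_ge0 (mulr_ge0 K0 N0) l0.
have p3 := mulr_ge0 (mulr_ge0 K0 N2) l0.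
by apply/and3P; split;
  [move: c1 g1 h1 p1|move: c3 g2 h2 p2|move: c2 g3 h3 p3];
  clear -K L M N l d e; lra.
Qed.

Lemma sample_rate_ge1 (R : realType) n (d : R) : 0 < d -> d <= 1 ->
  1 <= sample_rate n d.
Proof.
move=> d0 d1; rewrite /sample_rate le_max; apply/orP; left.
rewrite ler_pdivlMr ?exprn_gt0 // mul1r (le_trans _ (loglog_inv_ge1 d)) //.
by rewrite exprn_ile1 // ltW.
Qed.

(** As [ln 2 >= 1/2], [j <= 1 + 2 * v], so the argument of the logarithm is at most [200 * v ^+ 2].
    Then [ln 200 <= 9] and [2 * ln v] add up to at most 11 times [loglog_inv d]. *)
Lemma confidence_loglog (R : realType) j (d : R) : 0 < d -> d <= 1 ->
  (forall i, j = i.+1 -> d < (2^-1) ^+ i) -> confidence j <= 11 * loglog_inv d.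
Proof.
move=> d0 d1 hj; pose u := ln d^-1; pose v := Num.max 1 u.
have v1 : 1 <= v by rewrite le_max lexx.
have uv : u <= v by rewrite le_max lexx orbT.
have ln2 : 2^-1 <= ln 2 :> R.
  have -> : ln 2 = - ln (2^-1) :> R by rewrite lnV ?opprK ?posrE.
  rewrite lerNr (_ : 2^-1 = 1 + - 2^-1 :> R); last by lra.
  rewrite (_ : - (1 + - 2^-1) = - 2^-1 :> R); last by lra.
  by apply: le_ln1Dx; lra.
have jv : j%:R <= 1 + 2 * v.
  case: j hj => [|i] hj; first by lra.
  have := hj i erefl; rewrite -ltf_pV2 ?posrE ?half_pow_gt0 // -exprVn invrK => h.
  have : ln (2 ^+ i) < u by rewrite ltr_ln ?posrE ?exprn_gt0 ?invr_gt0.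
  rewrite lnXn // -[ln 2 *+ i]mulr_natl -(natr1 i) => h2.
  have h3 : i%:R * 2^-1 <= i%:R * ln 2 :> R by rewrite ler_wpM2l.
  lra.
have v0 : 0 < v by lra.
have lnv : ln v <= loglog_inv d.
  rewrite /loglog_inv -/u /v; case: (leP 1 u) => hu; first by rewrite le_max lexx orbT.
  by rewrite ln1 le_max ler01.
have l1 := loglog_inv_ge1 d.
apply: (@le_trans _ _ (ln (200 * v ^+ 2))).
  rewrite ler_ln ?posrE ?confidence_arg_gt0 ?mulr_gt0 ?exprn_gt0 //.
  rewrite -(natr1 j.+1) -(natr1 j); have : 0 <= j%:R :> R by [].
  by nra.
rewrite lnM ?posrE ?exprn_gt0 // lnXn // -[ln v *+ 2]mulr_natl.
have : ln 200 <= 9 :> R.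
  rewrite -ler_expR lnK ?posrE // -[9]mulr_natl expRM_natl.
  have h : 2 <= expR 1 :> R by have := expR_ge1Dx (1 : R); lra.
  apply: (@le_trans _ _ (2 ^+ 9)); first by rewrite -natrX ler_nat.
  by rewrite lerXn2r ?nnegrE // expR_ge0.
lra.
Qed.

(** [j] is the least exponent satisfying the first clause; the last clause records minimality. *)
Lemma half_pow_bracket (R : realType) (d : R) : 0 < d -> d <= 1 ->
  exists j, [/\ (2^-1) ^+ j <= d, d <= 2 * (2^-1) ^+ j &
                forall i, j = i.+1 -> d < (2^-1) ^+ i].
Proof.
move=> d0 d1.
have ex : exists j, (2^-1) ^+ j <= d.
  exists (Num.truncn d^-1).+1.
  rewrite exprVn -[leRHS]invrK lef_pV2 ?posrE ?exprn_gt0 ?invr_gt0 //.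
  apply: (@le_trans _ _ (Num.truncn d^-1).+1%:R); first by rewrite ltW // truncnS_gt.
  by rewrite -natrX ler_nat ltnW // ltn_expl.
case: (ex_minnP ex) => j hj jmin; exists j.
have h i : j = i.+1 -> d < (2^-1) ^+ i.
  by move=> ji; rewrite ltNge; apply/negP => /jmin; rewrite ji ltnn.
split=> //; case: j {hj jmin} h => [|i] h; first by rewrite expr0; lra.
by rewrite exprS mulrA divff ?mul1r ?pnatr_eq0 // ltW // h.
Qed.

(** * The stopping rule *)

Definition stage_threshold (R : realType) (n j : nat) : R :=
  Num.sqrt (128 * (stage_size R n j)%:R * confidence j).

(** The order expected by [closeness_stat]: two blocks, each with [m] entries of [x] followed by [m]
    of [y]. *)
Definition stage_sample (T : Type) (m : nat) (x y : seq T) : seq T :=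
  (take m x ++ take m y) ++ (take m (drop m x) ++ take m (drop m y)).

Definition stage_laws (R : realType) (n j : nat) (D1 D2 : {ffun 'I_n -> R}) :=
  sample_block (stage_size R n j) D1 D2 ++ sample_block (stage_size R n j) D1 D2.

Definition stage_rejects (R : realType) (n j : nat) (s : seq 'I_n) : bool :=
  stage_threshold R n j <= closeness_stat (stage_size R n j) s.

(** All stages restart from time 0 and share the samples; independence between stages is replaced by
    a union bound. Equality is never declared, and [j < k] keeps the search finite. *)
Definition closeness_rule (R : realType) (n : nat) : test_rule n :=
  fun k x y =>
    if [exists j : 'I_k, (stage_size R n j + stage_size R n j <= k)%N &&
          stage_rejects R j (stage_sample (stage_size R n j) x y)]
    then @Ordinal 3 2 isT else ord0.

Lemma stage_sample_cat (T : Type) (m : nat) (x y z w : seq T) :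
  (m + m <= size x)%N -> (m + m <= size y)%N ->
  stage_sample m (x ++ z) (y ++ w) = stage_sample m x y.
Proof.
move=> hx hy; have hx' := leq_trans (leq_addr m m) hx.
have hy' := leq_trans (leq_addr m m) hy.
by rewrite /stage_sample !take_drop !takel_cat.
Qed.

(** A completed stage reads only a prefix of the streams, so its rejection survives any
    extension. *)
Lemma closeness_rule_stopping (R : realType) (n : nat) :
  stopping_rule (closeness_rule R (n := n)).
Proof.
move=> k l x y z w; rewrite /closeness_rule.
case: existsP => // -[j /andP[mk rej]] _.
case: existsP => // -[]; exists (widen_ord (leq_addr l k) j).
by rewrite /= (leq_trans mk (leq_addr l k)) stage_sample_cat ?size_tuple.
Qed.

Definition stage_index (m : nat) : seq (nat + nat) :=
  ([seq inl t | t <- iota 0 m] ++ [seq inr t | t <- iota 0 m]) ++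
  ([seq inl t | t <- iota m m] ++ [seq inr t | t <- iota m m]).

Definition sample_at (Omega T : Type) (X Y : nat -> Omega -> T) (s : nat + nat) :
    Omega -> T :=
  match s with inl t => X t | inr t => Y t end.

Lemma stage_index_uniq m : uniq (stage_index m).
Proof.
rewrite (@perm_uniq _ _ ([seq inl t | t <- iota 0 (m + m)] ++
                         [seq inr t | t <- iota 0 (m + m)])); last first.
  by rewrite !iotaD !map_cat /stage_index perm_catACA.
rewrite cat_uniq !map_inj_uniq ?iota_uniq; try by move=> a b [].
by rewrite andbT /=; apply/hasPn => s /mapP[t _ ->]; apply/negP => /mapP[].
Qed.

Lemma tval_mktuple_iota (T : Type) (f : nat -> T) k :
  tval [tuple f i | i < k] = [seq f i | i <- iota 0 k].
Proof. by rewrite /= -val_enum_ord -map_comp. Qed.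

Lemma stage_sample_streams (n : nat) (Omega : Type) (X Y : nat -> Omega -> 'I_n)
    (m k : nat) (w : Omega) : (m + m <= k)%N ->
  stage_sample m [seq X i w | i <- iota 0 k] [seq Y i w | i <- iota 0 k] =
  [seq sample_at X Y s w | s <- stage_index m].
Proof.
move=> mk; have mk' := leq_trans (leq_addr m m) mk.
rewrite /stage_sample -!map_drop -!map_take drop_iota !take_iota.
have -> : minn m k = m by apply/minn_idPl.
have -> : minn m (k - m) = m by apply/minn_idPl; rewrite leq_subRL.
by rewrite /stage_index !map_cat -!map_comp.
Qed.

(** Rejection at stage [j] on the infinite streams, free of the current time, so that the errors can
    be summed over stages. *)
Definition stage_event (R : realType) (n : nat) (Omega : Type)
    (X Y : nat -> Omega -> 'I_n) (j : nat) : set Omega :=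
  [set w | stage_rejects R j
     [seq sample_at X Y s w | s <- stage_index (stage_size R n j)]].

Lemma outputP (R : realType) (n : nat) (Omega : Type)
    (X Y : nat -> Omega -> 'I_n) t w :
  output (closeness_rule R (n := n)) X Y t w = 2%N <->
  exists j, [/\ (j < t)%N, (stage_size R n j + stage_size R n j <= t)%N &
                stage_event R X Y j w].
Proof.
rewrite /output /closeness_rule.
rewrite (tval_mktuple_iota (X^~ w)) (tval_mktuple_iota (Y^~ w)).
case: existsP => h; split=> //.
  case: h => j /andP[mk rej] _; exists j; split=> //.
  by move: rej; rewrite stage_sample_streams.
move=> [j [jt mk rej]]; case: h; exists (Ordinal jt) => /=.
by rewrite mk /= stage_sample_streams.
Qed.

Lemma output_neq0 (R : realType) (n : nat) (Omega : Type)
    (X Y : nat -> Omega -> 'I_n) t w :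
  output (closeness_rule R (n := n)) X Y t w <> 0%N <->
  output (closeness_rule R (n := n)) X Y t w = 2%N.
Proof. by rewrite /output /closeness_rule; case: existsP. Qed.

Lemma distribution_dim_gt0 (R : realType) (n : nat) (D : {ffun 'I_n -> R}) :
  is_distribution D -> (0 < n)%N.
Proof.
case: n D => // D [_]; rewrite big_ord0 => /esym /eqP.
by rewrite oner_eq0.
Qed.

(** * Error probabilities and sample size of the rule on random streams *)

Section Streams.
Context (R : realType) (n : nat) (D1 D2 : {ffun 'I_n -> R}).
Context (disp : measure_display) (Omega : measurableType disp).
Context (P : probability Omega R) (X Y : nat -> Omega -> 'I_n).
Context (hD1 : is_distribution D1) (hD2 : is_distribution D2).
Context (hXY : iid_samples D1 D2 P X Y).

Lemma measurable_sample s (B : set 'I_n) : measurable (sample_at X Y s @^-1` B).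
Proof. by case: hXY => mXY _ _ _; case: s => t; case: (mXY t B). Qed.

Lemma measurable_stage_event j : measurable (stage_event R X Y j).
Proof. exact: measurable_joint measurable_sample. Qed.

Lemma probability_stage_event j :
  P (stage_event R X Y j) =
  (expect (stage_laws j D1 D2) (fun s => (stage_rejects R j s)%:R))%:E.
Proof.
case: hXY => _ hX hY indep.
pose law (s : nat + nat) := match s with inl _ => D1 | inr _ => D2 end.
rewrite (@probability_joint R _ _ P _ n (sample_at X Y) law _ _) //.
- congr (expect _ _)%:E.
  rewrite /stage_index !map_cat -!map_comp /stage_laws /sample_block.
  have cst (D : {ffun 'I_n -> R}) (a b : nat) :
      [seq D | _ <- iota a b] = nseq b D by elim: b a => //= b IH a; rewrite IH.
  by congr ((_ ++ _) ++ (_ ++ _)); apply: cst.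
- exact: measurable_sample.
- by case=> t a; [exact: hX|exact: hY].
- exact: stage_index_uniq.
- exact: distribution_dim_gt0 hD1.
Qed.

Lemma distributions_stage_laws j : distributions (stage_laws j D1 D2).
Proof. by apply: distributions_cat; apply: distributions_block. Qed.

Lemma stage_tail (b : bool) j :
  expect (stage_laws j D1 D2) (fun s => (stage_threshold R n j <=
     (-1) ^+ b * (closeness_stat (stage_size R n j) s -
       expect (stage_laws j D1 D2) (closeness_stat (stage_size R n j))))%R%:R)
    <= (10 * (j.+1%:R * j.+2%:R))^-1.
Proof.
have [jm hL] := stage_ok_large (stage_size_ok R n j).
have -> : (10 * (j.+1%:R * j.+2%:R))^-1 = expR (- confidence j) :> R.
  by rewrite /confidence expRN lnK // posrE confidence_arg_gt0.
apply: closeness_stat_tail => //.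
- exact: distributions_stage_laws.
- by rewrite size_cat !size_block !addnn -!muln2 -mulnA mulnC.
- exact: leq_ltn_trans jm.
- exact: le_trans ler01 (confidence_ge1 R j).
Qed.

(** The statistic has mean zero here, so rejection is an upper deviation by the threshold. *)
Lemma stage_false_alarm j : D1 = D2 ->
  (P (stage_event R X Y j) <= ((10 * (j.+1%:R * j.+2%:R))^-1)%:E)%E.
Proof.
move=> D12; rewrite probability_stage_event lee_fin.
apply: le_trans (stage_tail false j); apply: le_expect.
  exact: distributions_stage_laws.
move=> s; rewrite expect_closeness_stat //.
rewrite big1 ?subr0 ?expr0 ?mul1r // => i _.
by rewrite big1 // => k _; rewrite D12 subrr expr0n.
Qed.

(** The mean is at least twice the threshold, so a missed rejection is a lower deviation by the
    threshold. *)
Lemma stage_detects j : (2^-1) ^+ j <= TV D1 D2 ->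
  ((9 / 10)%:E <= P (stage_event R X Y j))%E.
Proof.
move=> hd; rewrite probability_stage_event lee_fin.
set m := stage_size R n j; set ds := stage_laws j D1 D2.
have hds : distributions ds by exact: distributions_stage_laws.
have gap : 2 * stage_threshold R n j <= expect ds (closeness_stat m).
  apply: stage_gap (stage_size_ok R n j) hd _; first exact: distribution_dim_gt0 hD1.
  exact: closeness_stat_lower.
have tail := stage_tail true j; rewrite -/m -/ds in tail.
apply: (@le_trans _ _ (1 - expect ds (fun s => (stage_threshold R n j <=
     (-1) ^+ true * (closeness_stat m s - expect ds (closeness_stat m)))%R%:R))).
  have : (10 * (j.+1%:R * j.+2%:R))^-1 <= 10^-1 :> R.
    rewrite lef_pV2 ?posrE ?confidence_arg_gt0 // ler_peMr //.
    by rewrite mulr_ege1 // ler1n.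
  by move=> h; rewrite lerBrDr -lerBrDl (le_trans tail) // (le_trans h) //; lra.
rewrite -[X in X - _](expect_cst 1 hds) -expectB; apply: le_expect => // s.
rewrite /stage_rejects -/m; case: (leP (stage_threshold R n j) (closeness_stat m s)) => h.
  by rewrite mulr1n lerBlDr lerDl.
have -> : stage_threshold R n j <=
    (-1) ^+ true * (closeness_stat m s - expect ds (closeness_stat m)).
  by rewrite expr1 mulN1r opprB; move: gap; lra.
by rewrite subrr.
Qed.

Lemma false_alarm : D1 = D2 ->
  (P [set w | exists t : nat, output (closeness_rule R (n := n)) X Y t w <> 0%N]
     <= (1 / 10)%:E)%E.
Proof.
move=> D12; set A := mkset _.
have AE : A = \bigcup_j stage_event R X Y j.
  apply/seteqP; split=> w.
    by move=> [t /output_neq0 /outputP[j [_ _ h]]]; exists j.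
  (* A time late enough both to exceed [j] and to complete the stage. *)
  move=> [j _ h]; exists (j.+1 + (stage_size R n j + stage_size R n j))%N.
  by apply/output_neq0/outputP; exists j; rewrite leq_addr leq_addl.
have mA : measurable A.
  by rewrite AE; apply: bigcup_measurable => j _; exact: measurable_stage_event.
apply: (@le_trans _ _ (\sum_(0 <= j <oo) P (stage_event R X Y j))%E).
  apply: measure_sigma_subadditive => //; last by rewrite AE.
  exact: measurable_stage_event.
apply: lime_le; first by apply: is_cvg_nneseries => j _ _; exact: measure_ge0.
apply: nearW => N.
apply: (@le_trans _ _ (\sum_(0 <= j < N) ((10 * (j.+1%:R * j.+2%:R))^-1)%:E)%E).
  by apply: lee_sum => j _; exact: stage_false_alarm.
rewrite sumEFin lee_fin.
have -> : \sum_(0 <= j < N) (10 * (j.+1%:R * j.+2%:R))^-1 =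
    (1 - N.+1%:R^-1) / 10 :> R.
  elim: N => [|N IH]; first by rewrite big_geq // invr1 subrr mul0r.
  rewrite big_nat_recr //= IH -(natr1 N.+1) -(natr1 N).
  have : 0 <= N%:R :> R by [].
  by move=> h; field; rewrite !lt0r_neq0 //; lra.
by rewrite ler_wpM2r ?invr_ge0 // lerBlDr lerDl invr_ge0.
Qed.

(** One stage with [2^-j] within a factor 2 of the distance suffices. It ends at time [2 m] with
    [m <= 176 * K * r + 1], and [r >= 1] absorbs the rounding: hence [352 * K + 2]. *)
Lemma detection (C : R) : 352 * stage_const + 2 <= C -> D1 <> D2 ->
  ((9 / 10)%:E <= P [set w | exists t : nat,
      output (closeness_rule R (n := n)) X Y t w = 2%N /\
      (t%:R <= C * sample_rate n (TV D1 D2))%R])%E.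
Proof.
move=> hC D12; set A := mkset _.
have d0 : 0 < TV D1 D2.
  rewrite /TV mulr_gt0 ?invr_gt0 // lt_def sumr_ge0 // andbT.
  apply/eqP => /eqP; rewrite psumr_eq0 // => /allP h; apply: D12.
  apply/ffunP => i; apply/eqP; rewrite -subr_eq0 -normr_eq0.
  by apply: h; rewrite mem_index_enum.
have d1 : TV D1 D2 <= 1.
  rewrite /TV ler_pdivrMl // mulr1.
  apply: (@le_trans _ _ (\sum_(i < n) (D1 i + D2 i))).
    apply: ler_sum => i _; apply: le_trans (ler_normB _ _) _.
    by rewrite !ger0_norm //; [case: hD2|case: hD1].
  by rewrite big_split /= (proj2 hD1) (proj2 hD2).
have [j [je ej hj]] := half_pow_bracket d0 d1.
have hL := confidence_loglog d0 d1 hj.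
have r1 := sample_rate_ge1 n d0 d1.
set r := sample_rate n _ in r1 *.
(* A countable union over the stages that fit in the budget: this gives measurability and contains
   the event of stage [j]. *)
have Ae : A = \bigcup_(i in [set i | exists t : nat, [/\ (i < t)%N,
    (stage_size R n i + stage_size R n i <= t)%N & t%:R <= C * r]])
    stage_event R X Y i.
  apply/seteqP; split=> w.
    by move=> [t [/outputP[i [it mt h]] tC]]; exists i => //; exists t.
  move=> [i [t [it mt tC]] h]; exists t; split=> //.
  by apply/outputP; exists i.
have mA : measurable A.
  by rewrite Ae; apply: bigcup_measurable => i _; exact: measurable_stage_event.
apply: le_trans (stage_detects je) _.
apply: le_measure; rewrite ?inE //; first exact: measurable_stage_event.
rewrite Ae; apply: bigcup_sup.
set m := stage_size R n j.
exists (m + m)%N; split=> //.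
  by rewrite (leq_trans (proj1 (stage_ok_large (stage_size_ok R n j)))) // leq_addr.
have K1 := stage_const_ge1 R; move: stage_const (@stage_ok_rate R n j) hC K1 => K.
move=> okK hC K1.
have x0 : 0 <= 176 * K * r by rewrite !mulr_ge0 // ?(le_trans ler01 K1) ?(le_trans ler01 r1).
have hm : m%:R <= 176 * K * r + 1.
  apply: (@le_trans _ _ (Num.truncn (176 * K * r)).+1%:R).
    rewrite ler_nat; apply: stage_size_le; apply: okK d0 ej hL _.
    by rewrite ltW // truncnS_gt.
  by rewrite -natr1 lerD2r truncn_le.
rewrite natrD; apply: (@le_trans _ _ ((352 * K + 2) * r)).
  by move: hm r1; move: (m%:R) => M; lra.
by rewrite ler_wpM2r // (le_trans ler01).
Qed.

End Streams.

Theorem theorem9 (R : realType) :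
  exists C : R, 0 < C /\
    forall n : nat, exists T : test_rule n, stopping_rule T /\
      forall D1 D2 : {ffun 'I_n -> R},
        is_distribution D1 -> is_distribution D2 ->
      forall (disp : measure_display) (Omega : measurableType disp)
             (P : probability Omega R) (X Y : nat -> Omega -> 'I_n),
        iid_samples D1 D2 P X Y ->
        (D1 = D2 ->
           (P [set w | exists t : nat, output T X Y t w <> 0%N]
              <= (1 / 10)%:E)%E) /\
        (D1 <> D2 ->
           ((9 / 10)%:E <=
              P [set w | exists t : nat,
                   output T X Y t w = 2%N /\
                   (t%:R <= C * sample_rate n (TV D1 D2))%R])%E).
Proof.
exists (352 * stage_const + 2); split.
  by have := stage_const_ge1 R; move: stage_const => K K1; lra.
move=> n; exists (closeness_rule R (n := n)); split.
  exact: closeness_rule_stopping.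
move=> D1 D2 h1 h2 disp Omega P X Y hXY; split.
  exact: false_alarm hXY.
exact: detection.
Qed.
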